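(* Let $k$ be a countable commutative field of characteristic $p>0$ with infinite degree of imperfection, and let $((X_i)_{i\ge 1},t)$ be a $p$-independent family of elements of $k$. Put $M_1=k\big((X_i^{p^{-1}})_{i\ge1}\big)$ and $M_2=k\big((X_i^{p^{-2}})_{i\ge1}\big)$. Let $E$ be the set of proper subextensions of $M_1$ (over $k$); $E$ is countable, and is presented in the form $E=(L_n)_{n\ge 3}$. By application of the extension step recalled in the context, one constructs an increasing sequence of extensions $(M_n/k)_{n\ge 3}$ satisfying: (i) $M_n/L_n$ is not modular; (ii) $M_n/k$ is equiexponential of exponent $n$. Put $K=\bigcup_{n\ge1}M_n$. Then the extension $K/k$ so constructed is modular and $+\infty$-$w_0$-generated, of infinite degree of irrationality.
   Context: All extensions are purely inseparable subextensions of a fixed algebraic closure $\Omega$ of $k$. The degree of imperfection of $k$ is the cardinality of a $p$-basis of $k$ (an $r$-basis of $k/k^p$). A family of elements of $k$ is $p$-independent if any finitely many distinct members $x_1,\dots,x_r$ satisfy $[k^p(x_1,\dots,x_r):k^p]=p^r$. $K/k$ is of finite (bounded) exponent if $K^{p^e}\subseteq k$ for some $e\in\mathbf N$ (the least such $e$ being its exponent); otherwise it is of unbounded exponent. An $r$-basis of $K/k$ is a subset $B\subseteq K$ with $K=k(K^p)(B)$ and $x\notin k(K^p)(B\setminus\{x\})$ for all $x\in B$; all $r$-bases have the same cardinality. If $K/k$ has finite exponent, its degree of irrationality $di(K/k)$ is the cardinality of an $r$-basis (equivalently, of a minimal generating set). In general $di(K/k)=\sup_{n\ge 1} di\big((k^{p^{-n}}\cap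 K)/k\big)$ (supremum of cardinals), where $k^{p^{-n}}=\{a\in\Omega : a^{p^n}\in k\}$. $K/k$ is modular if for every $n\in\mathbf N$, $K^{p^n}$ and $k$ are linearly disjoint over $K^{p^n}\cap k$. For $a\in K$, $o(a,k)=\min\{m\in\mathbf N: a^{p^m}\in k\}$. An extension $K/k$ of exponent $e$ is equiexponential of exponent $e$ if it has an $r$-basis $G$ such that $K\simeq\bigotimes_{k,\,a\in G}k(a)$ (tensor product over $k$, taken as direct limit of finite tensor products) and $o(a,k)=e$ for all $a\in G$. Extension step used in the construction: if $F/k$ is a purely inseparable equiexponential extension of exponent $n>1$ with $k\not\subseteq F^p$, and $L/k$ is a proper subextension of $k^{p^{-1}}\cap F$, then there is an extension $F'/F$ such that $di(F'/k)=di(F/k)$, $F'/k$ is equiexponential of exponent $n+1$, and $F'/L$ is not modular. For an integer $j\ge1$, $K/k$ is $j$-$w_0$-generated if it has no proper subextension of unbounded exponent whose degree of irrationality over $k$ is at most $j$. $K/k$ is $+\infty$-$w_0$-generated if it is $j$-$w_0$-generated for every integer $j\ge 1$.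
   Formalization: E is in fact uncountable: only proper subextensions of finite degree (other than k) are shown countable and must occur among the L_n; each extension step also keeps k^{1/p}∩M_{n+1}=k^{1/p}∩M_n, since equality of infinite di alone does not suffice. *)

(* Defs.v *)
(* Subfields of an ambient field R, and extensions K/F inside R, are
   represented by sets F, K : set R. *)
From HB Require Import structures.
From mathcomp Require Import all_boot all_order all_algebra.
From mathcomp Require Import all_classical.

Set Implicit Arguments.
Unset Strict Implicit.
Unset Printing Implicit Defensive.

Import GRing.Theory.
Local Open Scope classical_set_scope.
Local Open Scope card_scope.
Local Open Scope ring_scope.

Definition is_subfield (R : fieldType) (A : set R) : Prop :=
  GRing.divring_closed [in A].

Definition adjoin (R : fieldType) (F S : set R) : set R :=
  smallest (@is_subfield R) (F `|` S).

Definition powers (R : fieldType) (q : nat) (K : set R) : set R :=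
  [set x ^+ q | x in K].

Definition roots (R : fieldType) (q : nat) (F : set R) : set R :=
  [set a | F (a ^+ q)].

Definition purely_insep (R : fieldType) (p : nat) (F K : set R) : Prop :=
  [/\ is_subfield K, F `<=` K &
      forall x, K x -> exists n : nat, F (x ^+ (p ^ n))].

(* "Proper" excludes both ends: every extension considered below is modular
   over its base, so the trivial subextension has to be left out. *)
Definition proper_subext (R : fieldType) (F L K : set R) : Prop :=
  [/\ is_subfield L, F `<` L & L `<` K].

Definition lin_indep (R : fieldType) (F : set R) (n : nat)
    (x : 'I_n -> R) : Prop :=
  forall c : 'I_n -> R, (forall i, F (c i)) ->
    \sum_i c i * x i = 0 -> forall i, c i = 0.

Definition lin_disjoint (R : fieldType) (A B C : set R) : Prop :=
  forall (n : nat) (x : 'I_n -> R), (forall i, A (x i)) ->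
    lin_indep C x -> lin_indep B x.

(* [K : F] = d, d a natural number *)
Definition has_degree (R : fieldType) (F K : set R) (d : nat) : Prop :=
  exists b : 'I_d -> R,
    [/\ forall i, K (b i), lin_indep F b &
        forall x, K x -> exists2 c : 'I_d -> R,
          forall i, F (c i) & x = \sum_i c i * b i].

Definition is_rbasis (R : fieldType) (p : nat) (F K B : set R) : Prop :=
  [/\ B `<=` K, K = adjoin (adjoin F (powers p K)) B &
      forall x, B x -> ~ adjoin (adjoin F (powers p K)) (B `\ x) x].

(* The degree of imperfection of k, the cardinality of a p-basis, is infinite. *)
Definition infinite_imperfection (k : fieldType) (p : nat) : Prop :=
  exists2 B : set k, is_rbasis p (powers p [set: k]) [set: k] B &
    infinite_set B.

(* "Distinct members" of the family means members with distinct indices. *)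
Definition p_independent (k : fieldType) (p : nat) (I : Type)
    (x : I -> k) : Prop :=
  forall (r : nat) (i : 'I_r -> I), injective i ->
    has_degree (powers p [set: k])
      (adjoin (powers p [set: k]) (range (x \o i))) (p ^ r).

Definition exponent_le (R : fieldType) (p : nat) (F K : set R)
    (e : nat) : Prop :=
  powers (p ^ e) K `<=` F.

Definition has_exponent (R : fieldType) (p : nat) (F K : set R)
    (e : nat) : Prop :=
  exponent_le p F K e /\ forall m, exponent_le p F K m -> (e <= m)%N.

Definition unbounded_exponent (R : fieldType) (p : nat) (F K : set R) : Prop :=
  ~ exists e, exponent_le p F K e.

(* di(K/F) is the cardinality of C: card C is the supremum over n >= 1 of the
   cardinalities of the r-bases of (F^(p^-n) \cap K)/F.  Such a supremum is at
   most the cardinality of R, so sets C, D : set R represent all the cardinals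
   that matter. *)
Definition has_di (R : fieldType) (p : nat) (F K C : set R) : Prop :=
  let le_card (D : set R) := forall (n : nat) (B : set R), (0 < n)%N ->
    is_rbasis p F (roots (p ^ n) F `&` K) B -> B #<= D in
  le_card C /\ forall D, le_card D -> C #<= D.

Definition di_le (R : fieldType) (p : nat) (F K : set R) (j : nat) : Prop :=
  exists2 C, has_di p F K C & C #<= `I_j.

Definition di_infinite (R : fieldType) (p : nat) (F K : set R) : Prop :=
  exists2 C, has_di p F K C & infinite_set C.

Definition di_eq (R : fieldType) (p : nat) (F K K' : set R) : Prop :=
  exists2 C, has_di p F K C & has_di p F K' C.

Definition modular (R : fieldType) (p : nat) (F K : set R) : Prop :=
  forall n, lin_disjoint (powers (p ^ n) K) F (powers (p ^ n) K `&` F).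

Definition multilinear_on (k R : fieldType) (iota : {rmorphism k -> R})
    (n : nat) (A : 'I_n -> set R) (V : lmodType k)
    (phi : ('I_n -> R) -> V) : Prop :=
  forall (i : 'I_n) (x : 'I_n -> R) (y z : R) (c : k),
    (forall j, A j (x j)) -> A i y -> A i z ->
    phi [eta x with i |-> iota c * y + z] =
      c *: phi [eta x with i |-> y] + phi [eta x with i |-> z].

Definition linear_on (k R : fieldType) (iota : {rmorphism k -> R})
    (T : set R) (V : lmodType k) (f : R -> V) : Prop :=
  forall (c : k) (x y : R), T x -> T y ->
    f (iota c * x + y) = c *: f x + f y.

(* T, with the multiplication map (x_i)_i |-> \prod_i x_i, is the tensor
   product of the A i over k (universal property for k-multilinear maps). *)
Definition is_tensor_product (k R : fieldType) (iota : {rmorphism k -> R})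
    (n : nat) (A : 'I_n -> set R) (T : set R) : Prop :=
  (forall x : 'I_n -> R, (forall i, A i (x i)) -> T (\prod_i x i)) /\
  forall (V : lmodType k) (phi : ('I_n -> R) -> V),
    multilinear_on iota A phi ->
    let factors (f : R -> V) := linear_on iota T f /\
      forall x : 'I_n -> R, (forall i, A i (x i)) -> f (\prod_i x i) = phi x in
    exists2 f, factors f & forall g, factors g -> forall x, T x -> f x = g x.

(* K is canonically the tensor product over k of the k(a), a \in G: it is the
   directed union of the k(a_1, ..., a_n), for distinct a_i in G, each of which
   is the tensor product of the k(a_i).  As K/k is purely inseparable, a
   k-algebra isomorphism from the tensor product onto K which restricts to
   embeddings of the k(a) in R can only be this canonical one. *)
Definition tensor_decomposition (k R : fieldType) (iota : {rmorphism k -> R})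
    (K G : set R) : Prop :=
  K = \bigcup_(n in [set: nat])
        \bigcup_(a in [set a : 'I_n -> R | injective a /\ range a `<=` G])
          adjoin (range iota) (range a) /\
  forall (n : nat) (a : 'I_n -> R), injective a -> range a `<=` G ->
    is_tensor_product iota (fun i => adjoin (range iota) [set a i])
      (adjoin (range iota) (range a)).

(* o(a, F) = e *)
Definition has_order (R : fieldType) (p : nat) (F : set R) (a : R)
    (e : nat) : Prop :=
  F (a ^+ (p ^ e)) /\ forall m, F (a ^+ (p ^ m)) -> (e <= m)%N.

Definition equiexponential (k R : fieldType) (iota : {rmorphism k -> R})
    (p : nat) (K : set R) (e : nat) : Prop :=
  [/\ purely_insep p (range iota) K, has_exponent p (range iota) K e &
      exists G : set R,
        [/\ is_rbasis p (range iota) K G, tensor_decomposition iota K G &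
            forall a, G a -> has_order p (range iota) a e]].

Definition w0_generated (R : fieldType) (p : nat) (F K : set R)
    (j : nat) : Prop :=
  ~ exists L, [/\ proper_subext F L K, unbounded_exponent p F L &
                  di_le p F L j].

Definition infty_w0_generated (R : fieldType) (p : nat) (F K : set R) : Prop :=
  forall j, (0 < j)%N -> w0_generated p F K j.

(* k((X_i^(1/q))_i) *)
Definition root_ext (k R : fieldType) (iota : {rmorphism k -> R})
    (q : nat) (X : nat -> k) : set R :=
  adjoin (range iota) [set a | exists i, a ^+ q = iota (X i)].

Definition finite_proper_subexts (R : fieldType) (F K : set R) :
    set (set R) :=
  [set L | proper_subext F L K /\ exists d, has_degree F L d].

(* The set of all proper subextensions of M1/k is uncountable; only its
   members of finite degree are required to occur among the L_n, n >= 3. *)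
Definition enumerates_proper_subexts (R : fieldType) (F K : set R)
    (L : nat -> set R) : Prop :=
  (forall n, (3 <= n)%N -> proper_subext F (L n) K) /\
  forall N, finite_proper_subexts F K N -> exists2 n, (3 <= n)%N & L n = N.

(* M' is obtained from M/k, equiexponential of exponent n, by the extension
   step relative to L.  The equality k^(1/p) \cap M' = k^(1/p) \cap M is
   equivalent to di(M'/k) = di(M/k) when these are finite; when they are
   infinite it is what keeps M' from acquiring new elements of exponent 1. *)
Definition extension_step (k R : fieldType) (iota : {rmorphism k -> R})
    (p n : nat) (M L M' : set R) : Prop :=
  [/\ M `<=` M',
      di_eq p (range iota) M' M,
      roots p (range iota) `&` M' = roots p (range iota) `&` M,
      equiexponential iota p M' n.+1 &
      ~ modular p L M'].

Definition tower (k R : fieldType) (iota : {rmorphism k -> R})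
    (p : nat) (X : nat -> k) (L M : nat -> set R) : Prop :=
  [/\ M 1%N = root_ext iota p X,
      M 2%N = root_ext iota (p ^ 2) X &
      forall n, (2 <= n)%N -> extension_step iota p n (M n) (L n.+1) (M n.+1)].

(* Main.v *)
From HB Require Import structures.
From mathcomp Require Import all_boot all_order all_algebra.
From mathcomp Require Import all_classical.
From mathcomp Require Import ring zify.
Require Import Defs.

(** Everything is reduced to subsets G of the algebraic closure such that the
    (p^e)-th powers of G are r-independent over k and their p-th powers lie
    in k; then k(G)/k is equiexponential of exponent e + 1, and conversely.
    For such a G, an element of k(G) whose p^m-th power is in k belongs to
    k(G^(p^(e+1-m))), and k(G^(p^m)) is built over k \cap k(G)^(p^m) by
    generators that stay independent over k: hence modularity.

    Extension step.  M' = k(G^(1/p)) works for most choices of the r-basis G of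
    M.  If M'/L is modular, an element of L that is a combination of powers of
    some s in k, with coefficients in N = M'^(p^n), has these coefficients in L.
    Let g be the p^(n-1)-th power of a generator and f = P(g) in L, P not
    constant.  Replacing this generator so that g - w becomes (g - w)/s, with
    s = t^(p^(n-1)) outside N, the expansion of f along the powers of g - w
    splits over the powers of s, so that (g - w)P'(g) is in L.  Taking for w the
    elements 0, 1 and the p^(n-1)-th powers of the other generators yields
    M_1 <= L, a contradiction.

    Generation.  Let L/k be a subextension of K of unbounded exponent with
    di(L/k) finite.  The finite extensions k^(1/p) \cap k(L^(p^m)) \cap L
    decrease with m, hence stabilise to some Q <> k.  Modularity of K/k shows
    that Q is generated over k by Q \cap K^(p^m) for each m, so that every
    M_n/Q is modular; but Q is one of the L_n. *)

Set Implicit Arguments.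
Unset Strict Implicit.
Unset Printing Implicit Defensive.

Import GRing.Theory.
Local Open Scope classical_set_scope.
Local Open Scope card_scope.
Local Open Scope ring_scope.

(** * Subfields *)

Section SubfieldType.
Variables (R : fieldType) (A : set R) (sfA : is_subfield A).

(** The closure proof is a phantom argument from which instance inference recovers the structure.
    [subfield_type] is then a genuine field, over which polynomial division, gcds and matrix kernels
    are available. *)
Definition subfield_pred (_ : is_subfield A) : {pred R} := [in A].

HB.instance Definition _ :=
  GRing.isDivringClosed.Build R (subfield_pred sfA) sfA.

Record subfield_type := SubfieldType {
  subfield_val :> R; _ : subfield_val \in subfield_pred sfA }.

HB.instance Definition _ := [isSub for subfield_val].
HB.instance Definition _ := [Choice of subfield_type by <:].
HB.instance Definition _ := [SubChoice_isSubIntegralDomain of subfield_type by <:].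
HB.instance Definition _ := [SubIntegralDomain_isSubField of subfield_type by <:].
End SubfieldType.

Section SubfieldTheory.
Variable R : fieldType.
Implicit Types (A B C F S T Y : set R) (x y a : R).

Lemma subfieldP A : A 1 -> (forall x y, A x -> A y -> A (x - y)) ->
  (forall x y, A x -> A y -> A (x / y)) -> is_subfield A.
Proof.
move=> A1 AB AD; split=> [|x y|x y]; rewrite !inE //; [exact: AB|exact: AD].
Qed.

Section Closure.
Variables (A : set R) (sfA : is_subfield A).

Lemma subfield1 : A 1. Proof. by case: sfA; rewrite !inE. Qed.

Lemma subfieldB x y : A x -> A y -> A (x - y).
Proof. by case: sfA => _ AB _ Ax Ay; rewrite -in_setE; apply: AB; rewrite inE. Qed.

Lemma subfield_div x y : A x -> A y -> A (x / y).
Proof. by case: sfA => _ _ AD Ax Ay; rewrite -in_setE; apply: AD; rewrite inE. Qed.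

Lemma subfield0 : A 0.
Proof. by rewrite -(subrr 1); apply: subfieldB; exact: subfield1. Qed.

Lemma subfieldN x : A x -> A (- x).
Proof. by rewrite -sub0r; apply: subfieldB; exact: subfield0. Qed.

Lemma subfieldD x y : A x -> A y -> A (x + y).
Proof. by move=> Ax /subfieldN Ay; rewrite -[y]opprK; apply: subfieldB. Qed.

Lemma subfieldV x : A x -> A x^-1.
Proof. by rewrite -[x^-1]mul1r; apply: subfield_div; exact: subfield1. Qed.

Lemma subfieldM x y : A x -> A y -> A (x * y).
Proof. by move=> Ax /subfieldV Ay; rewrite -[y]invrK; apply: subfield_div. Qed.

Lemma subfieldX x n : A x -> A (x ^+ n).
Proof.
move=> Ax; elim: n => [|n IHn]; first exact: subfield1.
by rewrite exprS; apply: subfieldM.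
Qed.

Lemma subfieldMn x n : A x -> A (x *+ n).
Proof.
move=> Ax; elim: n => [|n IHn]; first exact: subfield0.
by rewrite mulrS; apply: subfieldD.
Qed.

Lemma subfield_sum (I : Type) (r : seq I) (P : pred I) (f : I -> R) :
  (forall i, P i -> A (f i)) -> A (\sum_(i <- r | P i) f i).
Proof.
move=> Af; elim/big_ind: _ => //; [exact: subfield0|exact: subfieldD].
Qed.

Lemma subfield_prod (I : Type) (r : seq I) (P : pred I) (f : I -> R) :
  (forall i, P i -> A (f i)) -> A (\prod_(i <- r | P i) f i).
Proof.
move=> Af; elim/big_ind: _ => //; [exact: subfield1|exact: subfieldM].
Qed.

Lemma subfield_horner (P : {poly R}) x :
  (forall i, A P`_i) -> A x -> A P.[x].
Proof.
move=> AP Ax; rewrite horner_coef; apply: subfield_sum => i _.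
by apply: subfieldM; [exact: AP|exact: subfieldX].
Qed.

Lemma subfield_typeP x : A x -> exists u : subfield_type sfA, x = val u.
Proof.
rewrite -in_setE => Ax.
by exists (SubfieldType (Ax : x \in subfield_pred sfA)).
Qed.

Lemma subfield_valP (u : subfield_type sfA) : A (val u).
Proof. by rewrite -in_setE; exact: (valP u). Qed.

Lemma subfield_polyP (P : {poly R}) : (forall i, A P`_i) ->
  exists Q : {poly subfield_type sfA}, P = map_poly val Q.
Proof.
move=> AP; have /choice[u uE] i := subfield_typeP (AP i).
exists (\poly_(i < size P) u i); apply/polyP => i.
rewrite coef_map coef_poly /=; case: ltnP => [_|le_P_i]; first exact: uE.
by rewrite nth_default // raddf0.
Qed.

Lemma subfield_poly_coef (Q : {poly subfield_type sfA}) i :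
  A (map_poly val Q)`_i.
Proof. by rewrite coef_map; exact: subfield_valP. Qed.

End Closure.

Lemma subfield_setI A B : is_subfield A -> is_subfield B ->
  is_subfield (A `&` B).
Proof.
move=> sfA sfB; apply: subfieldP => [|x y [Ax Bx] [Ay By]|x y [Ax Bx] [Ay By]].
- by split; exact: subfield1.
- by split; exact: subfieldB.
- by split; exact: subfield_div.
Qed.

Lemma subfield_bigcup (M : nat -> set R) (P : set nat) :
  P !=set0 -> (forall n, P n -> is_subfield (M n)) ->
  (forall m n, P m -> P n -> exists i, [/\ P i, M m `<=` M i & M n `<=` M i]) ->
  is_subfield (\bigcup_(n in P) M n).
Proof.
move=> [n0 Pn0] sfM dirM; apply: subfieldP => [|x y|x y].
- by exists n0 => //; apply: subfield1; exact: sfM.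
- move=> [m Pm Mx] [n Pn My]; have [i [Pi mi ni]] := dirM _ _ Pm Pn.
  by exists i => //; apply: (subfieldB (sfM i Pi)); [exact: mi|exact: ni].
- move=> [m Pm Mx] [n Pn My]; have [i [Pi mi ni]] := dirM _ _ Pm Pn.
  by exists i => //; apply: (subfield_div (sfM i Pi)); [exact: mi|exact: ni].
Qed.

Lemma adjoin_subfield F S : is_subfield (adjoin F S).
Proof.
apply: subfieldP => [B [sfB _]|x y Ax Ay B BP|x y Ax Ay B BP].
- exact: subfield1.
- by apply: subfieldB; [case: BP|exact: Ax|exact: Ay].
- by apply: subfield_div; [case: BP|exact: Ax|exact: Ay].
Qed.

Lemma sub_adjoin F S : F `<=` adjoin F S.
Proof. by move=> x Fx B [_]; apply; left. Qed.

Lemma mem_adjoin F S : S `<=` adjoin F S.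
Proof. by move=> x Sx B [_]; apply; right. Qed.

Lemma adjoin_min F S A :
  is_subfield A -> F `<=` A -> S `<=` A -> adjoin F S `<=` A.
Proof.
by move=> sfA FA SA x; apply; split=> // y [/FA|/SA].
Qed.

Lemma adjoin_mono F S F' S' :
  F `<=` adjoin F' S' -> S `<=` adjoin F' S' -> adjoin F S `<=` adjoin F' S'.
Proof. by apply: adjoin_min; exact: adjoin_subfield. Qed.

Lemma adjoinS F S S' : S `<=` S' -> adjoin F S `<=` adjoin F S'.
Proof.
move=> SS'; apply: adjoin_mono; first exact: sub_adjoin.
by apply: subset_trans SS' _; exact: mem_adjoin.
Qed.

Lemma adjoinSl F F' S : F `<=` F' -> adjoin F S `<=` adjoin F' S.
Proof.
move=> FF'; apply: adjoin_mono; last exact: mem_adjoin.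
by apply: subset_trans FF' _; exact: sub_adjoin.
Qed.

Lemma adjoin_id F S : is_subfield F -> S `<=` F -> adjoin F S = F.
Proof.
by move=> sfF SF; apply/seteqP; split; [exact: adjoin_min|exact: sub_adjoin].
Qed.

Lemma adjoinU F S S' : adjoin (adjoin F S) S' = adjoin F (S `|` S').
Proof.
apply/seteqP; split; apply: adjoin_mono.
- by apply: adjoinS; left.
- by move=> x S'x; apply: mem_adjoin; right.
- by apply: subset_trans (@sub_adjoin _ _); exact: sub_adjoin.
- move=> x [Sx|S'x]; last exact: mem_adjoin.
  by apply: sub_adjoin; exact: mem_adjoin.
Qed.

Lemma adjoin_finite F S x : adjoin F S x ->
  exists2 s : seq R, [set` s] `<=` S & adjoin F [set` s] x.
Proof.
pose Z := [set x | exists2 s : seq R, [set` s] `<=` S & adjoin F [set` s] x].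
have Z2 x1 x2 : Z x1 -> Z x2 -> exists s : seq R,
    [/\ [set` s] `<=` S, adjoin F [set` s] x1 & adjoin F [set` s] x2].
  move=> [s sS sx] [s' s'S s'x]; exists (s ++ s'); split.
  - by move=> y /=; rewrite mem_cat => /orP[/sS|/s'S].
  - by move: sx; apply: adjoinS => y /=; rewrite mem_cat => ->.
  - by move: s'x; apply: adjoinS => y /=; rewrite mem_cat orbC => ->.
apply: (@adjoin_min _ _ Z); first apply: subfieldP.
- by exists [::] => //; apply: (subfield1 (adjoin_subfield _ _)).
- move=> x1 x2 Zx1 Zx2; have [s [sS s1 s2]] := Z2 _ _ Zx1 Zx2.
  by exists s => //; apply: (subfieldB (adjoin_subfield _ _)).
- move=> x1 x2 Zx1 Zx2; have [s [sS s1 s2]] := Z2 _ _ Zx1 Zx2.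
  by exists s => //; apply: (subfield_div (adjoin_subfield _ _)).
- by move=> y Fy; exists [::] => //; exact: sub_adjoin.
- move=> y Sy; exists [:: y]; last by apply: mem_adjoin; rewrite /= inE.
  by move=> z /=; rewrite inE => /eqP ->.
Qed.

(* Adds the elements of a finite generating set of x one at a time until x
   appears. *)
Lemma adjoin_peel F S x : is_subfield F -> adjoin F S x -> ~ F x ->
  exists (g : R) (s : seq R), [/\ S g, [set` s] `<=` S `\ g,
    ~ adjoin F [set` s] x & adjoin (adjoin F [set` s]) [set g] x].
Proof.
move=> sfF /adjoin_finite[s]; elim: s => [|g s IHs] sS sx nFx.
  by case: nFx; rewrite -(adjoin_id sfF (S := [set` [::]])).
have [sx'|nsx] := pselect (adjoin F [set` s] x).
  by apply: IHs => // y /= ys; apply: sS; rewrite /= inE ys orbT.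
have sgx : adjoin (adjoin F [set` s]) [set g] x.
  rewrite adjoinU; move: sx; apply: adjoinS => y /=.
  by rewrite inE => /orP[/eqP->|]; [right|left].
exists g, s; split=> //; first by apply: sS; rewrite /= mem_head.
move=> y /= ys; split; first by apply: sS; rewrite /= inE ys orbT.
move=> yg; apply: nsx; rewrite -(adjoin_id (adjoin_subfield F [set` s]) (S := [set g])) //.
by move=> _ ->; apply: mem_adjoin; rewrite /= -yg.
Qed.

End SubfieldTheory.

(** * Images and preimages of subfields *)

Section Morphism.
Variables (R R' : fieldType) (f : {rmorphism R -> R'}).

Lemma subfield_preimage A :
  is_subfield A -> is_subfield (f @^-1` A).
Proof.
move=> sfA; apply: subfieldP => [|x y|x y] /=; rewrite ?rmorph1 ?rmorphB ?fmorph_div.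
- exact: subfield1.
- exact: subfieldB.
- exact: subfield_div.
Qed.

Lemma subfield_image A : is_subfield A -> is_subfield (f @` A).
Proof.
move=> sfA; apply: subfieldP => [|_ _ [x Ax <-] [y Ay <-]|_ _ [x Ax <-] [y Ay <-]].
- by exists 1; [exact: subfield1|rewrite rmorph1].
- by exists (x - y); [exact: subfieldB|rewrite rmorphB].
- by exists (x / y); [exact: subfield_div|rewrite fmorph_div].
Qed.

Lemma image_adjoin F S : f @` (adjoin F S) = adjoin (f @` F) (f @` S).
Proof.
apply/seteqP; split.
  move=> _ [x Fx <-]; suff: (f @^-1` adjoin (f @` F) (f @` S)) x by [].
  move: x Fx; apply: adjoin_min.
  - by apply: subfield_preimage; exact: adjoin_subfield.
  - by move=> x Fx; apply: sub_adjoin; exists x.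
  - by move=> x Sx; apply: mem_adjoin; exists x.
apply: adjoin_min.
- by apply: subfield_image; exact: adjoin_subfield.
- by apply: image_subset; exact: sub_adjoin.
- by apply: image_subset; exact: mem_adjoin.
Qed.

Lemma image_fmorphE (A : set R) x : (f @` A) (f x) = A x.
Proof.
apply/propext; split=> [[y Ay /fmorph_inj <-]//|Ax]; by exists x.
Qed.

End Morphism.

(** * Iterates of Frobenius *)

Section Frobenius.
Variables (R : comNzRingType) (p : nat).

(** The characteristic is a phantom argument so that ring morphism instances can be attached to this
    map. *)
Definition frobenius (_ : p \in [pchar R]) (n : nat) (x : R) := x ^+ (p ^ n).

Variable (char_p : p \in [pchar R]).

Lemma frobenius_is_zmod n : zmod_morphism (frobenius char_p n).
Proof.
move=> x y; rewrite /frobenius; elim: n => [|n IHn]; first by rewrite !expr1.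
by rewrite expnSr !exprM IHn -!(pFrobenius_autE char_p) rmorphB.
Qed.

Lemma frobenius_is_monoid n : monoid_morphism (frobenius char_p n).
Proof. by split=> [|x y]; rewrite /frobenius ?expr1n ?exprMn. Qed.

HB.instance Definition _ n := GRing.isZmodMorphism.Build R R
  (frobenius char_p n) (frobenius_is_zmod n).
HB.instance Definition _ n := GRing.isMonoidMorphism.Build R R
  (frobenius char_p n) (frobenius_is_monoid n).

End Frobenius.

(** * Linear algebra over a subfield *)

Section LinearAlgebra.
Variable R : fieldType.
Implicit Types (A B C F L W : set R) (a x : R).

Definition lin_span F n (b : 'I_n -> R) : set R :=
  [set x | exists2 c : 'I_n -> R, forall i, F (c i) & x = \sum_i c i * b i].

Definition fcons (T : Type) n (a : T) (f : 'I_n -> T) (i : 'I_n.+1) : T :=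
  oapp f a (unlift ord0 i).

Lemma fcons0 (T : Type) n (a : T) (f : 'I_n -> T) : fcons a f ord0 = a.
Proof. by rewrite /fcons unlift_none. Qed.

Lemma fconsS (T : Type) n (a : T) (f : 'I_n -> T) i :
  fcons a f (lift ord0 i) = f i.
Proof. by rewrite /fcons liftK. Qed.

Lemma fconsP (T : Type) (P : T -> Prop) n (a : T) (f : 'I_n -> T) :
  P a -> (forall i, P (f i)) -> forall i, P (fcons a f i).
Proof. by move=> Pa Pf i; rewrite /fcons; case: unliftP => [j|] _ /=; [exact: Pf|]. Qed.

Lemma lin_indepS F F' n (x : 'I_n -> R) :
  F `<=` F' -> lin_indep F' x -> lin_indep F x.
Proof. by move=> FF' xi c Fc; apply: xi => i; exact: FF'. Qed.

Lemma lin_indep_cons F n (x : 'I_n -> R) a : is_subfield F ->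
  lin_indep F x -> ~ lin_span F x a -> lin_indep F (fcons a x).
Proof.
move=> sfF xi xa c Fc; rewrite big_ord_recl fcons0.
under eq_bigr do rewrite fconsS.
have [c0|c0] := eqVneq (c ord0) 0.
  rewrite c0 mul0r add0r => s0 i; have c1 := xi _ (fun i => Fc _) s0.
  by case: (unliftP ord0 i) => [j|] -> //; apply: c1.
move/eqP; rewrite addr_eq0 => /eqP cx; case: xa.
exists (fun i => - c (lift ord0 i) / c ord0) => [i|].
  by apply: subfield_div => //; apply: subfieldN.
apply: (mulfI c0); rewrite cx -sumrN mulr_sumr; apply: eq_bigr => i _.
by rewrite !mulNr mulrN mulrA mulrCA divff // mulr1.
Qed.

Lemma lin_span_id F n (b : 'I_n -> R) j : is_subfield F -> lin_span F b (b j).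
Proof.
move=> sfF; exists (fun i => (i == j)%:R) => [i|].
  by case: eqP => _; [exact: subfield1|exact: subfield0].
rewrite (bigD1 j) //= eqxx mul1r big1 ?addr0 // => i /negPf ->.
by rewrite mul0r.
Qed.

Lemma lin_span_cons F n (b : 'I_n -> R) a : is_subfield F ->
  lin_span F b `<=` lin_span F (fcons a b).
Proof.
move=> sfF _ [c Fc ->]; exists (fcons 0 c).
  by apply: fconsP => //; exact: subfield0.
rewrite big_ord_recl !fcons0 mul0r add0r.
by apply: eq_bigr => i _; rewrite !fconsS.
Qed.

Lemma lin_span_choice F n m (b : 'I_n -> R) (e : 'I_m -> R) :
  (forall i, lin_span F e (b i)) -> exists2 g : 'I_n -> 'I_m -> R,
    forall i j, F (g i j) & forall i, b i = \sum_j g i j * e j.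
Proof.
move=> be; have /choice[g gP] i : exists c : 'I_m -> R,
    (forall j, F (c j)) /\ b i = \sum_j c j * e j.
  by have [c] := be i; exists c.
by exists g => [i j|i]; have [] := gP i.
Qed.

(** Greedy extraction, started from 1 so that 1 itself is a basis vector: [equi_basis_socle_sub]
    reads off the coefficient at 1. *)
Lemma extract_basis C A n (b : 'I_n -> R) : is_subfield C ->
  A 1 -> (forall i, A (b i)) ->
  exists m (e : 'I_m -> R) i0, [/\ e i0 = 1, lin_indep C e,
    forall i, A (e i) & forall j, lin_span C e (b j)].
Proof.
move=> sfC A1; elim: n b => [|n IHn] b Ab.
  exists 1%N, (fun=> 1), ord0; split=> // [c _|[]//].
  by rewrite big_ord1 mulr1 => c0 i; rewrite ord1.
have [m [e [i0 [e1 ei Ae eb]]]] := IHn (fun i => b (lift ord0 i)) (fun i => Ab _).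
have [b0|b0] := pselect (lin_span C e (b ord0)).
  exists m, e, i0; split=> // j.
  by case: (unliftP ord0 j) => [i|] ->.
exists m.+1, (fcons (b ord0) e), (lift ord0 i0); split.
- by rewrite fconsS.
- exact: lin_indep_cons.
- by apply: fconsP => //; exact: Ab.
- move=> j; case: (unliftP ord0 j) => [i|] ->; first exact: lin_span_cons.
  by rewrite -[X in lin_span _ _ X](fcons0 (b ord0) e); exact: lin_span_id.
Qed.

(** The coefficients in A of a relation among the e_i are expanded, with g_ij in C, on elements b_j
    of A independent over C. The b_j stay independent over B, so each sum of the g_ij e_i over i
    vanishes, and all g_ij are 0 as the e_i are independent over C. *)
Lemma lin_disjointC A B C : is_subfield A -> is_subfield B -> is_subfield C ->
  C `<=` B -> lin_disjoint A B C -> lin_disjoint B A C.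
Proof.
move=> sfA sfB sfC CB dAB n e Be ei c Ac ce0.
have [m [b [_ [_ bi Ab /lin_span_choice[g gC gE]]]]] :=
  extract_basis sfC (subfield1 sfA) Ac.
have cE : \sum_j (\sum_i g i j * e i) * b j = 0.
  rewrite -[RHS]ce0; under [RHS]eq_bigr do rewrite gE mulr_suml.
  rewrite exchange_big /=; apply: eq_bigr => j _; rewrite mulr_suml.
  by apply: eq_bigr => i _; rewrite mulrAC.
have ge0 j : \sum_i g i j * e i = 0.
  apply: (dAB _ b Ab bi) cE _ => {}j.
  by apply: subfield_sum => // i _; apply: subfieldM => //; exact: CB.
by move=> i; rewrite gE big1 // => j _; rewrite (ei _ _ (ge0 j)) ?mul0r.
Qed.

Lemma lin_disjoint_refl A B : lin_disjoint A B B.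
Proof. by []. Qed.

Lemma lin_disjoint_sub A B : is_subfield A -> is_subfield B ->
  A `<=` B -> lin_disjoint A B (A `&` B).
Proof.
move=> sfA sfB AB; have -> : A `&` B = A by exact/setIidPl.
by apply: lin_disjointC => //; exact: lin_disjoint_refl.
Qed.

(** Were f = sum of y_i e_i outside the span of the e_i over A \cap L, then f and the e_i would be
    independent over A \cap L, hence over A, against the definition of f. So f has an expansion over
    A \cap L, equal to the given one by uniqueness over A. *)
Lemma coefs_in_subfield A L n (e y : 'I_n -> R) :
  is_subfield A -> is_subfield L -> lin_disjoint L A (A `&` L) ->
  (forall i, L (e i)) -> lin_indep A e -> (forall i, A (y i)) ->
  L (\sum_i y i * e i) -> forall i, L (y i).
Proof.
move=> sfA sfL dLA Le ei Ay; set f := \sum_i _ => Lf i.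
have [[g ALg fE]|fe] := pselect (lin_span (A `&` L) e f).
  have : \sum_i (y i - g i) * e i = 0.
    by under eq_bigr do rewrite mulrBl; rewrite sumrB -fE subrr.
  move/ei => yg; have /eqP := yg (fun i => subfieldB sfA (Ay i) (proj1 (ALg i))) i.
  by rewrite subr_eq0 => /eqP ->; case: (ALg i).
have ei' : lin_indep (A `&` L) e by apply: lin_indepS ei => ? [].
have Lfe : forall i, L (fcons f e i) by exact: fconsP.
have sfAL := subfield_setI sfA sfL.
have yA : forall i, A (fcons (-1) y i).
  by apply: fconsP => //; apply: subfieldN => //; exact: subfield1.
have := dLA _ _ Lfe (lin_indep_cons sfAL ei' fe) _ yA.
rewrite big_ord_recl !fcons0 mulN1r.
under eq_bigr do rewrite !fconsS.
by rewrite addNr => /(_ erefl ord0)/eqP; rewrite fcons0 oppr_eq0 oner_eq0.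
Qed.

(** If m exceeds #|T|, the coefficient matrix has a nonzero row vector in its left kernel, that is,
    a relation among the x_i. *)
Lemma steinitz F (T : finType) (b : T -> R) m (x : 'I_m -> R) :
  is_subfield F ->
  (forall i, exists2 c : T -> R, forall t, F (c t) & x i = \sum_t c t * b t) ->
  lin_indep F x -> (m <= #|T|)%N.
Proof.
move=> sfF bx xi; rewrite leqNgt; apply/negP => ltTm.
have /choice[c cP] i : exists c : T -> subfield_type sfF,
    x i = \sum_t val (c t) * b t.
  have [c Fc ->] := bx i; have /choice[u uE] t := subfield_typeP sfF (Fc t).
  by exists u; apply: eq_bigr => t _; rewrite uE.
pose M := \matrix_(i < m, j < #|T|) c i (enum_val j).
have : kermx M != 0.
  rewrite -mxrank_eq0 -lt0n mxrank_ker subn_gt0.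
  by rewrite (leq_ltn_trans (rank_leq_col M)).
case/rowV0Pn => v /sub_kermxP vM v0.
suff /xi v'0 : \sum_i val (v 0 i) * x i = 0.
  case/negP: v0; apply/eqP/rowP => i; rewrite mxE; apply: val_inj => /=.
  by rewrite v'0 // => j; exact: subfield_valP.
under eq_bigr do rewrite cP mulr_sumr; rewrite exchange_big /=.
apply: big1 => t _; under eq_bigr do rewrite mulrA.
rewrite -mulr_suml; suff -> : \sum_i val (v 0 i) * val (c i t) = 0 by rewrite mul0r.
have /rowP/(_ (enum_rank t)) := vM; rewrite !mxE => /(congr1 val) v0t.
rewrite -[RHS]/(val (0 : subfield_type sfF)) -v0t rmorph_sum.
by apply: eq_bigr => i _; rewrite mxE enum_rankK rmorphM.
Qed.

End LinearAlgebra.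

(** * Purely inseparable elements *)

Section PurelyInseparable.
Variables (R : fieldType) (p : nat) (char_p : p \in [pchar R]).
Implicit Types (A B C F L S T U V W Y : set R) (a x y : R) (P : {poly R}).

Let p_pr : prime p := pcharf_prime char_p.
Let p_gt0 : (0 < p)%N := prime_gt0 p_pr.

Lemma powersE n A : powers (p ^ n) A = frobenius char_p n @` A.
Proof. by []. Qed.

Lemma rootsE n A : roots (p ^ n) A = frobenius char_p n @^-1` A.
Proof. by []. Qed.

Lemma powers_mem n A x : powers (p ^ n) A (x ^+ (p ^ n)) = A x.
Proof. exact: (image_fmorphE (frobenius char_p n)). Qed.

Lemma subfield_powers n A : is_subfield A -> is_subfield (powers (p ^ n) A).
Proof. by rewrite powersE; exact: subfield_image. Qed.

Lemma subfield_roots n A : is_subfield A -> is_subfield (roots (p ^ n) A).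
Proof. by rewrite rootsE; exact: subfield_preimage. Qed.

Lemma powers_adjoin n F S :
  powers (p ^ n) (adjoin F S) = adjoin (powers (p ^ n) F) (powers (p ^ n) S).
Proof. by rewrite !powersE image_adjoin. Qed.

Lemma powers_powers m n A :
  powers (p ^ m) (powers (p ^ n) A) = powers (p ^ (n + m)) A.
Proof.
apply/seteqP; split=> [_ [_ [x Ax <-] <-]|_ [x Ax <-]].
  by exists x; rewrite // expnD exprM.
by exists (x ^+ (p ^ n)); [exists x|rewrite expnD exprM].
Qed.

Lemma powers0 A : powers (p ^ 0) A = A.
Proof.
by apply/seteqP; split=> [_ [x Ax <-]//|x Ax]; exists x.
Qed.

Lemma powersS n A B : A `<=` B -> powers (p ^ n) A `<=` powers (p ^ n) B.
Proof. by move=> AB _ [x /AB Bx <-]; exists x. Qed.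

Lemma powers_sub n A : is_subfield A -> powers (p ^ n) A `<=` A.
Proof. by move=> sfA _ [x Ax <-]; exact: subfieldX. Qed.

Lemma powers_le m n A : is_subfield A -> (m <= n)%N ->
  powers (p ^ n) A `<=` powers (p ^ m) A.
Proof.
move=> sfA /subnK <-; rewrite -powers_powers; apply: powersS.
exact: powers_sub.
Qed.

Lemma powers_rootsS n F G :
  powers (p ^ n) G `<=` F <-> G `<=` roots (p ^ n) F.
Proof.
split=> [GF x Gx|GF _ [x Gx <-]]; last exact: GF.
by apply: GF; exists x.
Qed.

Lemma expr_p_inj n : injective (fun x => x ^+ (p ^ n)).
Proof. exact: (fmorph_inj (frobenius char_p n)). Qed.

Lemma exprXsubC n a :
  ('X - a%:P) ^+ (p ^ n) = 'X^(p ^ n) - (a ^+ (p ^ n))%:P.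
Proof.
have char_poly : p \in [pchar {poly R}] by rewrite pchar_poly.
by rewrite -[LHS]/(frobenius char_poly n _) rmorphB /= /frobenius polyC_exp.
Qed.

Lemma subfield_expr_gcd Y a m n : is_subfield Y -> (0 < m)%N ->
  Y (a ^+ m) -> Y (a ^+ n) -> Y (a ^+ (gcdn m n)).
Proof.
move=> sfY m0 am an; have [->|a0] := eqVneq a 0.
  rewrite expr0n; case: eqP => _; [exact: subfield1|exact: subfield0].
case: (egcdnP n m0) => u v uv _.
have -> : a ^+ gcdn m n = (a ^+ m) ^+ u / (a ^+ n) ^+ v.
  rewrite -!exprM mulnC uv [(n * v)%N]mulnC exprD mulrAC divff ?mul1r //.
  by rewrite expf_neq0.
by apply: subfield_div => //; exact: subfieldX.
Qed.

Lemma map_val_XnsubC Y (sfY : is_subfield Y) n (c : subfield_type sfY) :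
  map_poly val ('X^n - c%:P) = 'X^n - (val c)%:P.
Proof.
by rewrite rmorphB; congr (_ - _); [exact: map_polyXn|exact: map_polyC].
Qed.

(** For P nonzero, the gcd of P and (X - a)^(p^(e+1)) has coefficients in Y and is a scalar multiple
    of (X - a)^k with 0 < k < p^(e+1). Its constant term puts a^k in Y; the gcd of k and p^(e+1) is
    some p^i with i <= e, so a^(p^e) would be in Y. *)
Lemma horner_eq0_small Y a e P : is_subfield Y ->
  Y (a ^+ (p ^ e.+1)) -> ~ Y (a ^+ (p ^ e)) -> (forall i, Y P`_i) ->
  (size P <= p ^ e.+1)%N -> P.[a] = 0 -> P = 0.
Proof.
move=> sfY Yaq nYa YP szP Pa0; apply: contrapT => /eqP P0.
have [Q PE] := subfield_polyP sfY YP; have [c cE] := subfield_typeP sfY Yaq.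
pose d := gcdp Q ('X^(p ^ e.+1) - c%:P); pose D := map_poly val d : {poly R}.
have DE : D = gcdp P (('X - a%:P) ^+ (p ^ e.+1)).
  by rewrite /D gcdp_map -PE exprXsubC map_val_XnsubC -cE.
have rD : root D a.
  rewrite DE root_gcd; apply/andP; split; first by apply/eqP.
  by rewrite rootE horner_exp hornerXsubC subrr expr0n expn_eq0 eqn0Ngt p_gt0 eqxx.
have /dvdp_exp_XsubCP[k _ Dk] : D %| ('X - a%:P) ^+ (p ^ e.+1).
  by rewrite DE dvdp_gcdr.
have k0 : (0 < k)%N.
  rewrite lt0n; apply: contraTneq rD => k0; move: Dk; rewrite k0 expr0.
  by move=> /eqp_root ->; rewrite root1.
have kq : (k < p ^ e.+1)%N.
  rewrite (leq_trans _ szP) // -(size_exp_XsubC k a) -(eqp_size Dk).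
  by apply: dvdp_leq => //; rewrite DE dvdp_gcdl.
have Yak : Y (a ^+ k).
  have YD i : Y D`_i by exact: subfield_poly_coef.
  have := congr1 (horner^~ 0) (eqpfP Dk).
  have mon : lead_coef (('X - a%:P) ^+ k) = 1.
    by apply/monicP; apply: monic_exp; exact: monicXsubC.
  rewrite mon divr1 hornerZ horner_exp hornerXsubC sub0r exprNn => D0.
  have lD0 : lead_coef D != 0.
    by rewrite lead_coef_eq0 DE gcdp_eq0 (negPf P0).
  have -> : a ^+ k = (-1) ^+ k * (D.[0] / lead_coef D).
    by rewrite D0 mulrAC divff // mul1r mulrA -expr2 sqrr_sign mul1r.
  apply: subfieldM => //.
    by apply: subfieldX => //; apply: subfieldN => //; exact: subfield1.
  apply: subfield_div => //; last exact: YD.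
  by apply: subfield_horner => //; exact: subfield0.
have /(dvdn_pfactor _ _ p_pr)[i ie gE] := dvdn_gcdr k (p ^ e.+1).
have Yg := subfield_expr_gcd sfY k0 Yak Yaq; rewrite gE in Yg.
apply: nYa; move: ie; rewrite leq_eqVlt => /orP[/eqP iE|].
  have := dvdn_gcdl k (p ^ e.+1); rewrite gE iE => /(dvdn_leq k0).
  by rewrite leqNgt kq.
rewrite ltnS => /subnKC <-; rewrite expnD exprM.
exact: subfieldX.
Qed.

(** The values Q(a) already form a field: with q = p^e, z^q lies in Y for each of them, so z^-1 =
    z^(q-1) / z^q. Reducing Q modulo X^q - a^q bounds its size. *)
Lemma adjoin1P Y a e x : is_subfield Y -> Y (a ^+ (p ^ e)) ->
  adjoin Y [set a] x -> exists P,
    [/\ forall i, Y P`_i, (size P <= p ^ e)%N & x = P.[a]].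
Proof.
move=> sfY Yaq; have [c cE] := subfield_typeP sfY Yaq.
pose ev (Q : {poly subfield_type sfY}) := (map_poly val Q).[a].
pose Z := [set x | exists Q, x = ev Q].
suff: adjoin Y [set a] `<=` Z.
  move=> /[apply] -[Q xE]; pose M := 'X^(p ^ e) - c%:P.
  have Mmon : M \is monic by rewrite monicXnsubC // expn_gt0 p_gt0.
  exists (map_poly val (Q %% M)); split; first exact: subfield_poly_coef.
    rewrite size_map_poly -ltnS -(@size_XnsubC _ (p ^ e) c) ?expn_gt0 ?p_gt0 //.
    by rewrite ltn_modp monic_neq0.
  have -> : x = ev (Q %/ M) * ev M + ev (Q %% M).
    by rewrite xE -hornerM -hornerD -rmorphM -rmorphD -divp_eq.
  suff -> : ev M = 0 by rewrite mulr0 add0r.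
  by rewrite /ev map_val_XnsubC hornerD hornerN hornerXn hornerC -cE subrr.
have Zpow y : Z y -> Y (y ^+ (p ^ e)).
  move=> [Q ->]; rewrite -[_ ^+ _]/(frobenius char_p e _) /ev -horner_map.
  apply: subfield_horner => // i; rewrite coef_map /= /frobenius.
  by apply: subfieldX => //; exact: subfield_poly_coef.
have ZM y z : Z y -> Z z -> Z (y * z).
  by move=> [Q ->] [Q' ->]; exists (Q * Q'); rewrite /ev rmorphM hornerM.
have ZX y n : Z y -> Z (y ^+ n).
  by move=> [Q ->]; exists (Q ^+ n); rewrite /ev rmorphXn horner_exp.
have ZC y : Y y -> Z y.
  move=> /(subfield_typeP sfY)[u ->]; exists u%:P.
  by rewrite /ev map_polyC hornerC.
apply: adjoin_min; first apply: subfieldP.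
- by exists 1; rewrite /ev rmorph1 hornerC.
- move=> y z [Q ->] [Q' ->]; exists (Q - Q').
  by rewrite /ev rmorphB hornerD hornerN.
- move=> y z Zy Zz; apply: (ZM _ _ Zy); have [->|z0] := eqVneq z 0.
    by rewrite invr0; apply: ZC; exact: subfield0.
  have -> : z^-1 = z ^+ (p ^ e).-1 * (z ^+ (p ^ e))^-1.
    apply: (mulfI z0); rewrite mulrA -exprS prednK ?expn_gt0 ?p_gt0 //.
    by rewrite !divff // expf_neq0.
  by apply: ZM; [exact: ZX|apply: ZC; apply: subfieldV => //; exact: Zpow].
- exact: ZC.
- by move=> _ ->; exists 'X; rewrite /ev map_polyX hornerX.
Qed.

Lemma purely_insep_adjoin F S x : is_subfield F ->
  (forall y, S y -> exists n, F (y ^+ (p ^ n))) ->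
  adjoin F S x -> exists n, F (x ^+ (p ^ n)).
Proof.
move=> sfF Sp; pose Z := [set y | exists n, F (y ^+ (p ^ n))].
have Z2 y z : Z y -> Z z -> exists n, F (y ^+ (p ^ n)) /\ F (z ^+ (p ^ n)).
  move=> [m Fy] [n Fz]; exists (m + n)%N; rewrite !expnD [in z ^+ _]mulnC.
  by rewrite !exprM; split; exact: subfieldX.
suff: adjoin F S `<=` Z by apply.
apply: adjoin_min => //; first apply: subfieldP.
- by exists 0%N; apply: subfield1.
- move=> y z Zy Zz; have [n [Fy Fz]] := Z2 _ _ Zy Zz; exists n.
  rewrite -[_ ^+ _]/(frobenius char_p n _) rmorphB; exact: subfieldB.
- move=> y z Zy Zz; have [n [Fy Fz]] := Z2 _ _ Zy Zz; exists n.
  by rewrite expr_div_n; exact: subfield_div.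
- by move=> y Fy; exists 0%N.
Qed.

End PurelyInseparable.

(** * Relative independence and socles *)

Definition rindep (R : fieldType) (F B : set R) : Prop :=
  forall x, B x -> ~ adjoin F (B `\ x) x.

(* The index is shifted: the generators have exponent e + 1. *)
Definition equi_basis (R : fieldType) (p : nat) (F : set R) (e : nat)
    (G : set R) : Prop :=
  powers (p ^ e.+1) G `<=` F /\ rindep F (powers (p ^ e) G).

Section RelativeIndependence.
Variables (R : fieldType) (p : nat) (char_p : p \in [pchar R]).
Implicit Types (A B C F G H L S T U V W Y : set R) (a x y : R) (P : {poly R}).

Let p_pr : prime p := pcharf_prime char_p.

Lemma horner_eq0_p Y a P : is_subfield Y -> Y (a ^+ p) -> ~ Y a ->
  (forall i, Y P`_i) -> (size P <= p)%N -> P.[a] = 0 -> P = 0.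
Proof.
by move=> sfY Yap nYa YP szP; apply: (@horner_eq0_small _ _ char_p Y _ 0).
Qed.

Lemma adjoin1_pP Y a x : is_subfield Y -> Y (a ^+ p) ->
  adjoin Y [set a] x -> exists P,
    [/\ forall i, Y P`_i, (size P <= p)%N & x = P.[a]].
Proof.
by move=> sfY Yap; apply: (@adjoin1P _ _ char_p _ _ 1%N).
Qed.

Lemma compositum_sum F B x : is_subfield F -> is_subfield B ->
  (forall y, B y -> exists n, F (y ^+ (p ^ n))) -> adjoin F B x ->
  exists2 s : seq (R * R), forall z, z \in s -> F z.1 /\ B z.2 &
    x = \sum_(z <- s) z.1 * z.2.
Proof.
move=> sfF sfB Bp Fx.
pose Z := [set x | exists2 s : seq (R * R),
  forall z, z \in s -> F z.1 /\ B z.2 & x = \sum_(z <- s) z.1 * z.2].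
have ZF y : F y -> Z y.
  move=> Fy; exists [:: (y, 1)]; last by rewrite big_seq1 mulr1.
  by move=> z; rewrite inE => /eqP ->; split=> //; exact: subfield1.
have ZD y z : Z y -> Z z -> Z (y + z).
  move=> [s sP ->] [s' s'P ->]; exists (s ++ s'); last by rewrite big_cat.
  by move=> u; rewrite mem_cat => /orP[/sP|/s'P].
have ZM y z : Z y -> Z z -> Z (y * z).
  move=> [s sP ->] [s' s'P ->].
  exists [seq (u.1 * v.1, u.2 * v.2) | u <- s, v <- s'].
    move=> _ /allpairsP[[u v] [/sP[Fu Bu] /s'P[Fv Bv] ->]].
    by split; exact: subfieldM.
  rewrite big_allpairs_dep mulr_suml; apply: eq_bigr => u _.
  by rewrite mulr_sumr; apply: eq_bigr => v _; rewrite mulrACA.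
have ZX y n : Z y -> Z (y ^+ n).
  move=> Zy; elim: n => [|n IHn]; first by apply: ZF; exact: subfield1.
  by rewrite exprS; exact: ZM.
have Zp y : Z y -> exists n, F (y ^+ (p ^ n)).
  move=> [s sP ->]; apply: (purely_insep_adjoin char_p sfF Bp).
  rewrite big_seq; apply: (subfield_sum (adjoin_subfield _ _)) => z /sP[Fz Bz].
  apply: (subfieldM (adjoin_subfield _ _)); first exact: sub_adjoin.
  exact: mem_adjoin.
move: x Fx; apply: adjoin_min => //; first apply: subfieldP.
- by apply: ZF; exact: subfield1.
- move=> y z Zy Zz; apply: ZD => //; rewrite -mulN1r; apply: ZM => //.
  by apply: ZF; apply: subfieldN => //; exact: subfield1.
- move=> y z Zy Zz; apply: (ZM _ _ Zy); have [->|z0] := eqVneq z 0.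
    by rewrite invr0; apply: ZF; exact: subfield0.
  have [n Fz] := Zp _ Zz.
  have -> : z^-1 = z ^+ (p ^ n).-1 * (z ^+ (p ^ n))^-1.
    apply: (mulfI z0); rewrite mulrA -exprS prednK ?expn_gt0 ?prime_gt0 //.
    by rewrite !divff // expf_neq0.
  by apply: ZM; [exact: ZX|apply: ZF; exact: subfieldV].
- move=> y By; exists [:: (1, y)]; last by rewrite big_seq1 mul1r.
  by move=> z; rewrite inE => /eqP ->; split=> //; exact: subfield1.
Qed.

(** The factors in F of a sum of products are expanded on elements of F independent over C, hence
    over A. The coefficients end up in any W containing B and C; a W smaller than A keeps extra
    information on them. *)
Lemma compositum_expand F A C W B x :
  is_subfield F -> is_subfield C -> is_subfield W -> is_subfield B ->
  C `<=` W -> B `<=` W -> lin_disjoint F A C ->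
  (forall y, B y -> exists n, F (y ^+ (p ^ n))) -> adjoin F B x ->
  exists n (e y : 'I_n -> R) i0, [/\ e i0 = 1,
    forall i, F (e i), lin_indep A e, forall i, W (y i) &
    x = \sum_i y i * e i].
Proof.
move=> sfF sfC sfW sfB CW BW dFA Bp /(compositum_sum sfF sfB Bp)[s sP xE].
pose t := in_tuple s; have ts i : tnth t i \in s by exact: mem_tnth.
have [] := @extract_basis _ C F _ (fun i => (tnth t i).1) sfC (subfield1 sfF).
  by move=> i; have [] := sP _ (ts i).
move=> n [e [i0 [ei0 eC eF /lin_span_choice[g gC gE]]]].
exists n, e, (fun j => \sum_i g i j * (tnth t i).2), i0; split=> //.
- exact: dFA.
- move=> j; apply: subfield_sum => // i _; apply: subfieldM => //.
    exact: CW.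
  by apply: BW; have [] := sP _ (ts i).
- rewrite xE big_tnth; under eq_bigr do rewrite gE mulr_suml.
  rewrite exchange_big /=; apply: eq_bigr => j _; rewrite mulr_suml.
  by apply: eq_bigr => i _; rewrite mulrAC.
Qed.

(** Write a = P(b) with deg P < p. If b were not in Y(a), then P - a, of degree < p over Y(a) and
    zero at b, would vanish, and a would be a coefficient of P. *)
Lemma adjoin1_exchange Y a b : is_subfield Y -> Y (a ^+ p) -> Y (b ^+ p) ->
  adjoin Y [set b] a -> ~ Y a -> adjoin Y [set a] b.
Proof.
move=> sfY Yap Ybp Yba nYa; have [P [YP szP aP]] := adjoin1_pP sfY Ybp Yba.
 apply: contrapT => nb.
apply: nYa; have YaY := @sub_adjoin _ Y [set a].
have Yaa : adjoin Y [set a] a by exact: mem_adjoin.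
have sfYa := adjoin_subfield Y [set a].
have : P - a%:P = 0.
  apply: (horner_eq0_p sfYa (YaY _ Ybp) nb).
  - move=> i; rewrite coefB coefC; apply: (subfieldB sfYa); first exact: YaY.
    by case: ifP => // _; exact: (subfield0 sfYa).
  - rewrite (leq_trans (size_polyD _ _)) // geq_max szP size_polyN.
    by rewrite (leq_trans (size_polyC_leq1 _)) // prime_gt0.
  - by rewrite hornerD hornerN hornerC -aP subrr.
by move=> /eqP; rewrite subr_eq0 => /eqP PE; have := YP 0%N; rewrite PE coefC.
Qed.

Lemma rindepS F B B' : B `<=` B' -> rindep F B' -> rindep F B.
Proof.
move=> BB' iB' x Bx; apply: contra_not (iB' _ (BB' _ Bx)).
by apply: adjoinS => y [/BB' By yx].
Qed.

Lemma rindepSl F F' B : F `<=` F' -> rindep F' B -> rindep F B.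
Proof.
move=> FF' iB x Bx; apply: contra_not (iB _ Bx); exact: adjoinSl.
Qed.

Lemma rindep_setU1 F B z : is_subfield F -> (forall x, B x -> F (x ^+ p)) ->
  F (z ^+ p) -> rindep F B -> ~ adjoin F B z -> rindep F (B `|` [set z]).
Proof.
move=> sfF Bp zp iB zB x Bzx.
have [xz|xz] := pselect (x = z).
  rewrite xz => /(@adjoinS _ _ _ B) h; apply: zB; apply: h.
  by move=> y [[//|yz] /(_ yz)].
have Bx : B x by case: Bzx.
move=> xB; apply: zB; have sfY := adjoin_subfield F (B `\ x).
have : adjoin (adjoin F (B `\ x)) [set x] z.
  apply: adjoin1_exchange => //; [|exact: sub_adjoin| |exact: iB].
    by apply: sub_adjoin; exact: Bp.
  rewrite adjoinU; move: xB; apply: adjoinS => y [[By|->] yx]; last by right.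
  by left; split.
by rewrite adjoinU; apply: adjoinS => y [[]//|->].
Qed.

Lemma powersD1 n B x :
  powers (p ^ n) (B `\ x) = powers (p ^ n) B `\ (x ^+ (p ^ n)).
Proof.
apply/seteqP; split=> [_ [y [By yx] <-]|_ [[y By <-] yx]].
  by split; [exists y|move=> /(expr_p_inj char_p) /yx].
by exists y => //; split=> // yE; apply: yx; rewrite yE.
Qed.

Lemma rindep_powers n F B :
  rindep (powers (p ^ n) F) (powers (p ^ n) B) <-> rindep F B.
Proof.
split=> [iB x Bx xB|iB _ [x Bx <-]].
  apply: (iB (x ^+ (p ^ n))); first by rewrite (powers_mem char_p).
  by rewrite -powersD1 -(powers_adjoin char_p) (powers_mem char_p).
rewrite -powersD1 -(powers_adjoin char_p) (powers_mem char_p).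
exact: iB.
Qed.

Lemma rindep_roots n F B :
  rindep F (powers (p ^ n) B) -> rindep (roots (p ^ n) F) B.
Proof.
move=> iB; apply/(@rindep_powers n); apply: rindepSl iB.
by move=> _ [x Fx <-].
Qed.

(** If x were outside S, one could peel off a generator g with x = P(g) over S(s), x not in S(s).
    Over T(s), which does not contain g, the polynomial P - x has degree < p and vanishes at g, so P
    is constant and x is in S(s). *)
Lemma adjoin_rindep_cap S T G x : is_subfield S -> is_subfield T -> S `<=` T ->
  (forall y, G y -> S (y ^+ p)) -> rindep T G -> adjoin S G x -> T x -> S x.
Proof.
move=> sfS sfT ST Gp iG Gx Tx; apply: contrapT => nSx.
have [g [s [Gg sG nsx]]] := adjoin_peel sfS Gx nSx.
have sfSs := adjoin_subfield S [set` s]; have sfTs := adjoin_subfield T [set` s].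
have Ssgp : adjoin S [set` s] (g ^+ p) by apply: sub_adjoin; exact: Gp.
have STs := @adjoinSl _ _ _ [set` s] ST.
move=> /(adjoin1_pP sfSs Ssgp)[P [SP szP xP]]; apply: nsx.
have : P - x%:P = 0.
  apply: (@horner_eq0_p (adjoin T [set` s]) g) => //.
  - exact: STs.
  - by apply: contra_not (iG _ Gg); exact: adjoinS.
  - move=> i; rewrite coefB coefC; apply: (subfieldB sfTs); first exact: STs.
    by case: ifP => _; [exact: sub_adjoin|exact: (subfield0 sfTs)].
  - rewrite (leq_trans (size_polyD _ _)) // geq_max szP size_polyN.
    by rewrite (leq_trans (size_polyC_leq1 _)) // prime_gt0.
  - by rewrite hornerD hornerN hornerC -xP subrr.
by move=> /eqP; rewrite subr_eq0 => /eqP PE; have := SP 0%N; rewrite PE coefC.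
Qed.

Lemma powers_le_sub m n F G : is_subfield F -> (m <= n)%N ->
  powers (p ^ m) G `<=` F -> powers (p ^ n) G `<=` F.
Proof.
move=> sfF /subnKC <- GF; rewrite -powers_powers => _ [y [x Gx <-] <-].
by apply: subfieldX => //; apply: GF; exists x.
Qed.

(** [adjoin_rindep_cap] applies with S = F(G^p) and T the field of p^e-th roots of F: S lies in T
    since G^(p^(e+1)) is in F, and G is independent over T since G^(p^e) is independent over F. *)
Lemma socle_step F e G x : is_subfield F -> equi_basis p F e G ->
  adjoin F G x -> roots (p ^ e) F x -> adjoin F (powers (p ^ 1) G) x.
Proof.
move=> sfF [Ge iG] Gx Tx; apply: (@adjoin_rindep_cap _ (roots (p ^ e) F) G) => //.
- exact: adjoin_subfield.
- exact: subfield_roots.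
- apply: adjoin_min; [exact: subfield_roots| |].
    by move=> y Fy; exact: subfieldX.
  by apply: (powers_rootsS _ _ _ _).1; rewrite powers_powers add1n.
- by move=> y Gy; apply: mem_adjoin; exists y; rewrite ?expn1.
- exact: rindep_roots.
- by move: Gx; apply: adjoinSl; exact: sub_adjoin.
Qed.

Lemma equi_basis_powers F d e G :
  equi_basis p F (d + e) G -> equi_basis p F e (powers (p ^ d) G).
Proof. by case=> Ge iG; split; rewrite powers_powers ?addnS. Qed.

Lemma equi_basisS F e G G' :
  G' `<=` G -> equi_basis p F e G -> equi_basis p F e G'.
Proof.
move=> G'G [Ge iG]; split; last by apply: rindepS iG; exact: powersS.
by apply: subset_trans Ge; exact: powersS.
Qed.

Lemma socle F d m G x : is_subfield F -> equi_basis p F (d + m) G ->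
  adjoin F G x -> roots (p ^ m.+1) F x -> adjoin F (powers (p ^ d) G) x.
Proof.
move=> sfF; elim: d G => [|d IHd] G bG Gx Tx; first by rewrite powers0.
have Gx1 : adjoin F (powers (p ^ 1) G) x.
  apply: (socle_step sfF bG) => //=; move: Tx; rewrite /roots /=.
  by rewrite addSn -addnS addnC expnD exprM; exact: subfieldX.
have := IHd _ (equi_basis_powers (d := 1) bG) Gx1 Tx.
by rewrite powers_powers add1n.
Qed.

(** Stronger than the hypothesis, where only the p^e-th powers of the other generators are adjoined:
    by [socle], an element of F(G \ g) whose p-th power is in F already lies in the field generated
    by those powers. *)
Lemma equi_basis_indep F e G g : is_subfield F -> equi_basis p F e G ->
  G g -> ~ adjoin F (G `\ g) (g ^+ (p ^ e)).
Proof.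
move=> sfF bG Gg gF; have [Ge iG] := bG.
have : adjoin F (powers (p ^ e) (G `\ g)) (g ^+ (p ^ e)).
  apply: (@socle F e 0); rewrite ?addn0 //; first exact: equi_basisS bG.
  by rewrite /roots /= -exprM -expnD addn1; apply: Ge; exists g.
by rewrite powersD1; apply: iG; exists g.
Qed.

Lemma adjoin_finite_family F S n (y : 'I_n -> R) : (forall i, adjoin F S (y i)) ->
  exists2 s : seq R, [set` s] `<=` S & forall i, adjoin F [set` s] (y i).
Proof.
move=> Fy; have /choice[s sP] i : exists s : seq R,
    [set` s] `<=` S /\ adjoin F [set` s] (y i).
  by have [s] := adjoin_finite (Fy i); exists s.
exists (flatten [seq s i | i <- enum 'I_n]) => [x /= /flattenP[_ /mapP[i _ ->] xs]|i].
  by have [sS _] := sP i; exact: sS.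
have [_] := sP i; apply: adjoinS => x /= xs; apply/flattenP; exists (s i) => //.
by rewrite map_f // mem_enum.
Qed.

(** Induction on the finitely many generators occurring in the coefficients y_i. Writing y_i =
    P_i(g) with P_i of size at most p^(e+1) over S(s), the sum of the t_i P_i has coefficients in
    T(s) and vanishes at g, so it is 0 by [horner_eq0_small]. Each power of g then gives a relation
    among the t_i over S(s). *)
Lemma equi_basis_lin_disjoint S T e G : is_subfield S -> is_subfield T ->
  S `<=` T -> powers (p ^ e.+1) G `<=` S -> rindep T (powers (p ^ e) G) ->
  lin_disjoint T (adjoin S G) S.
Proof.
move=> sfS sfT ST GS iG n t Tt it y /adjoin_finite_family[s sG].
have bT : equi_basis p T e G by split=> //; exact: subset_trans ST.
elim: s sG y => [|g s IHs] sG y ys y0.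
  by apply: it => // i; have := ys i; rewrite adjoin_id.
have sG' : [set` s] `<=` G by move=> z /= zs; apply: sG; rewrite /= inE zs orbT.
have [gs|gs] := boolP (g \in s).
  apply: IHs => // i; have := ys i; apply: adjoinS => z /=.
  by rewrite inE => /orP[/eqP ->|].
have Gg : G g by apply: sG; rewrite /= mem_head.
have sfSs := adjoin_subfield S [set` s]; have sfTs := adjoin_subfield T [set` s].
have STs := @adjoinSl _ _ _ [set` s] ST.
have gSp : adjoin S [set` s] (g ^+ (p ^ e.+1)) by apply: sub_adjoin; apply: GS; exists g.
have /choice[P PP] i : exists P, [/\ forall j, adjoin S [set` s] P`_j,
    (size P <= p ^ e.+1)%N & y i = P.[g]].
  apply: (adjoin1P char_p) => //; rewrite adjoinU; have := ys i; apply: adjoinS.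
  by move=> z /=; rewrite inE => /orP[/eqP ->|]; [right|left].
have PS i j : adjoin S [set` s] (P i)`_j by have [] := PP i.
have Q0 : \sum_i t i *: P i = 0.
  apply: (horner_eq0_small char_p sfTs (STs _ gSp)).
  - apply: contra_not (equi_basis_indep sfT bT Gg); apply: adjoinS => z /= zs.
    by split; [exact: sG'|move=> zg; move: gs; rewrite -zg zs].
  - move=> j; rewrite coef_sum; apply: (subfield_sum sfTs) => i _; rewrite coefZ.
    by apply: (subfieldM sfTs); [exact: sub_adjoin|exact: STs].
  - apply: (leq_trans (size_sum _ _ _)); apply/bigmax_leqP => i _.
    by rewrite (leq_trans (size_scale_leq _ _)) //; have [] := PP i.
  - rewrite horner_sum -[RHS]y0; apply: eq_bigr => i _.
    by rewrite hornerZ mulrC; have [_ _ <-] := PP i.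
have P0 j i : (P i)`_j = 0.
  apply: (IHs sG' (fun i => (P i)`_j)) i => //.
  rewrite -[RHS](coef0 R j) -Q0 coef_sum.
  by apply: eq_bigr => i _; rewrite coefZ mulrC.
move=> i; have [_ _ ->] := PP i; rewrite horner_coef big1 // => j _.
by rewrite P0 mul0r.
Qed.

Lemma powers_adjoin_exponent e F G : is_subfield F ->
  powers (p ^ e) G `<=` F -> powers (p ^ e) (adjoin F G) `<=` F.
Proof.
move=> sfF GF; apply: (powers_rootsS _ _ _ _).2; apply: adjoin_min.
- exact: subfield_roots.
- by move=> x Fx; exact: subfieldX.
- exact: (powers_rootsS _ _ _ _).1.
Qed.

Lemma equi_basis_modular F e G : is_subfield F -> equi_basis p F e G ->
  modular p F (adjoin F G).
Proof.
move=> sfF [Ge iG] m; have sfA := subfield_powers char_p m (adjoin_subfield F G).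
set A := powers _ _ in sfA *.
have [em|me] := ltnP e m.
  apply: lin_disjoint_sub => //; apply: powers_le_sub em _ => //.
  exact: powers_adjoin_exponent.
have sfD := subfield_setI sfA sfF.
have AE : A = adjoin (A `&` F) (powers (p ^ m) G).
  apply/seteqP; split.
    rewrite {1}/A (powers_adjoin char_p); apply: adjoinSl => x Fx; split.
      rewrite /A; move: Fx; apply: powersS; exact: sub_adjoin.
    by move: Fx; exact: powers_sub.
  apply: adjoin_min => //; apply: powersS; exact: mem_adjoin.
apply: lin_disjointC => //.
rewrite {1}AE; apply: (@equi_basis_lin_disjoint _ _ (e - m)) => //.
- rewrite powers_powers addnS subnKC // subsetI; split=> //.
  rewrite /A; apply: subset_trans (powers_le (adjoin_subfield F G) (leqW me)).
  by apply: powersS; exact: mem_adjoin.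
- by rewrite powers_powers subnKC.
Qed.

End RelativeIndependence.

(** * Equiexponential extensions *)

Section Coordinates.
Variables (R : fieldType) (p : nat) (char_p : p \in [pchar R]).
Variables (Y : set R) (sfY : is_subfield Y) (e : nat) (a : R).
Hypotheses (Yaq : Y (a ^+ (p ^ e.+1))) (nYa : ~ Y (a ^+ (p ^ e))).

Let coords_of x := [set P : {poly R} |
  [/\ forall i, Y P`_i, (size P <= p ^ e.+1)%N & x = P.[a]]].

(** The expansion of x on the powers a^r, r < p^(e+1), unique by [coordsE]. Outside Y(a) the value
    is the default 0. *)
Definition coords (x : R) : {poly R} := xget 0 (coords_of x).

Lemma coordsP x : adjoin Y [set a] x -> [/\ forall i, Y (coords x)`_i,
  (size (coords x) <= p ^ e.+1)%N & x = (coords x).[a]].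
Proof.
by move=> Yx; apply: (@xgetPex _ 0 (coords_of x)); exact: (adjoin1P char_p).
Qed.

Lemma coordsE (P : {poly R}) x : (forall i, Y P`_i) -> (size P <= p ^ e.+1)%N ->
  x = P.[a] -> coords x = P.
Proof.
move=> YP szP xP.
have [Yc szc xc] : coords_of x (coords x).
  by apply: (@xgetPex _ 0 (coords_of x)); exists P.
apply/eqP; rewrite -subr_eq0; apply/eqP.
apply: (horner_eq0_small char_p sfY Yaq nYa).
- by move=> i; rewrite coefB; exact: subfieldB.
- by rewrite (leq_trans (size_polyD _ _)) // geq_max szc size_polyN.
- by rewrite hornerD hornerN -xc -xP subrr.
Qed.

Lemma coords_linear c x y : Y c -> adjoin Y [set a] x -> adjoin Y [set a] y ->
  coords (c * x + y) = c *: coords x + coords y.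
Proof.
move=> Yc /coordsP[Yx szx xE] /coordsP[Yy szy yE]; apply: coordsE.
- by move=> i; rewrite coefD coefZ; apply: subfieldD => //; exact: subfieldM.
- rewrite (leq_trans (size_polyD _ _)) // geq_max szy andbT.
  by rewrite (leq_trans (size_scale_leq _ _)).
- by rewrite hornerD hornerZ -xE -yE.
Qed.
End Coordinates.

(** * Tensor products from independent generators *)

Section TensorProduct.
Variables (k R : fieldType) (iota : {rmorphism k -> R}).
Variables (p : nat) (char_p : p \in [pchar R]).
Implicit Types (A B F G K T : set R).

Local Notation F := (range iota).

Lemma subfield_range : is_subfield F.
Proof.
apply: subfield_image; apply: subfieldP => //.
Qed.
Let sfF := subfield_range.

Lemma in_range c : F (iota c). Proof. by exists c. Qed.

Section LinearOn.
Variables (T : set R) (sfT : is_subfield T) (FT : F `<=` T).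
Variables (V : lmodType k) (f : R -> V).
Hypothesis f_lin : linear_on iota T f.

Lemma linear_on0 : f 0 = 0.
Proof.
have T0 := subfield0 sfT; have := f_lin 1 T0 T0.
rewrite mulr0 addr0 scale1r => /eqP.
by rewrite -[X in X == _]addr0 (inj_eq (addrI _)) => /eqP ->.
Qed.

Lemma linear_onZ c x : T x -> f (iota c * x) = c *: f x.
Proof.
move=> Tx; have := f_lin c Tx (subfield0 sfT).
by rewrite !addr0 linear_on0 addr0.
Qed.

Lemma linear_on_sum n (c : 'I_n -> k) (x : 'I_n -> R) :
  (forall i, T (x i)) -> f (\sum_i iota (c i) * x i) = \sum_i c i *: f (x i).
Proof.
move=> Tx; pose Z := [set u : R * V | T u.1 /\ f u.1 = u.2].
suff [] : Z (\sum_i iota (c i) * x i, \sum_i c i *: f (x i)) by [].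
apply: (big_rec2 (fun y z => Z (y, z))) => [|i y z _ [/= Ty <-]].
  by split; [exact: subfield0|exact: linear_on0].
split=> /=; last exact: f_lin.
by apply: subfieldD => //; apply: subfieldM => //; apply: FT; exact: in_range.
Qed.
End LinearOn.

Lemma range_fcons n (a : R) (b : 'I_n -> R) :
  range (fcons a b) = range b `|` [set a].
Proof.
apply/seteqP; split=> [_ [i _ <-]|x [[i _ <-]|->]].
- by apply: fconsP => [|j]; [right|left; exists j].
- by exists (lift ord0 i); rewrite ?fconsS.
- by exists ord0; rewrite ?fcons0.
Qed.

Lemma fcons_eta (T : Type) n (x : 'I_n.+1 -> T) :
  x = fcons (x ord0) (fun i => x (lift ord0 i)).
Proof.
by apply/funext => i; case: (unliftP ord0 i) => [j|] ->; rewrite ?fconsS ?fcons0.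
Qed.

Lemma fcons_with0 n (y z : R) (x : 'I_n -> R) :
  ([eta fcons z x with ord0 |-> y] : 'I_n.+1 -> R) = fcons y x.
Proof.
apply/funext => i /=; case: (unliftP ord0 i) => [j|] ->.
  by rewrite !fconsS; case: eqP => // /esym/eqP; rewrite (negPf (neq_lift _ _)).
by rewrite eqxx fcons0.
Qed.

Lemma fcons_withS n (y z : R) (x : 'I_n -> R) i :
  ([eta fcons z x with lift ord0 i |-> y] : 'I_n.+1 -> R) =
    fcons z [eta x with i |-> y].
Proof.
apply/funext => j /=; case: (unliftP ord0 j) => [l|] ->.
  by rewrite !fconsS /= (inj_eq lift_inj).
by rewrite !fcons0 (negPf (neq_lift _ _)).
Qed.

(** Induction on n. With Y generated by the a_i other than a_0, the powers a_0^r for r < p^(e+1)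
    form a basis of T over Y. For fixed r, x |-> phi(a_0^r, x) factors through some f_r on Y, and
    phi factors through the map sending the sum of the c_r a_0^r to the sum of the f_r(c_r). *)
Lemma tensor_equi_basis e G n (a : 'I_n -> R) : equi_basis p F e G ->
  injective a -> range a `<=` G ->
  is_tensor_product iota (fun i => adjoin F [set a i]) (adjoin F (range a)).
Proof.
move=> bG; elim: n a => [|n IHn] a a_inj aG.
  have -> : adjoin F (range a) = F by apply: adjoin_id => // x [[]].
  split=> [x _|V phi phi_lin factors]; first by rewrite big_ord0; exact: subfield1.
  pose g x := xget 0 [set c | iota c = x].
  have gE c : g (iota c) = c.
    by apply: (fmorph_inj iota); apply: (@xgetPex _ 0 [set d | iota d = iota c]); exists c.
  exists (fun x => g x *: phi (fun=> 0)); first split.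
  - move=> c _ _ [x _ <-] [y _ <-].
    by rewrite -rmorphM -rmorphD !gE scalerDl scalerA.
  - move=> x _; rewrite big_ord0 -(rmorph1 iota) gE scale1r; congr phi.
    by apply/funext => -[].
  - move=> h [h_lin h1] _ [c _ <-]; rewrite gE -(h1 (fun=> 0)) => [|[]//].
    rewrite big_ord0 -(linear_onZ sfF h_lin) ?mulr1 //; exact: subfield1.
pose a0 := a ord0; pose a' i := a (lift ord0 i).
have a'G : range a' `<=` G by move=> _ [i _ <-]; apply: aG; exists (lift ord0 i).
have a'_inj : injective a' by move=> i j /a_inj/lift_inj.
have [_ IH] := IHn a' a'_inj a'G.
set Y := adjoin F (range a') in IH; have sfY : is_subfield Y := adjoin_subfield _ _.
have FY : F `<=` Y := @sub_adjoin _ _ _.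
have TE : adjoin F (range a) = adjoin Y [set a0].
  by rewrite adjoinU -range_fcons -fcons_eta.
have Ga0 : G a0 by apply: aG; exists ord0.
have Ya0 : Y (a0 ^+ (p ^ e.+1)) by apply: FY; case: bG => Ge _; apply: Ge; exists a0.
have nYa0 : ~ Y (a0 ^+ (p ^ e)).
  apply: contra_not (equi_basis_indep char_p sfF bG Ga0); apply: adjoinS.
  move=> _ [i _ <-]; split; first by apply: a'G; exists i.
  by move=> /a_inj /eqP; rewrite eq_sym (negPf (neq_lift _ _)).
have sfT := adjoin_subfield F (range a).
have Tprod (x : 'I_n.+1 -> R) :
    (forall i, adjoin F [set a i] (x i)) -> adjoin F (range a) (\prod_i x i).
  move=> Ax; apply: (subfield_prod sfT) => i _.
  by have := Ax i; apply: adjoinS => _ ->; exists i.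
split=> // V phi phi_lin factors.
pose A i := adjoin F [set a i]; pose A' i := adjoin F [set a' i].
have Aa0 r : A ord0 (a0 ^+ r).
  by apply: (subfieldX (adjoin_subfield _ _)); exact: mem_adjoin.
have phi0 (x : 'I_n -> R) : (forall i, A' i (x i)) ->
    linear_on iota (A ord0) (fun y => phi (fcons y x)).
  move=> A'x c y z Ay Az; rewrite -(fcons_with0 _ y x) phi_lin //.
    by rewrite !fcons_with0.
  by move=> i; case: (unliftP ord0 i) => [j|] ->; rewrite ?fconsS ?fcons0 //; exact: A'x.
have phiS r : multilinear_on iota A' (fun x => phi (fcons (a0 ^+ r) x)).
  move=> i x y z c A'x A'y A'z; rewrite -fcons_withS phi_lin //.
    by rewrite !fcons_withS.
  move=> j; case: (unliftP ord0 j) => [l|] ->; first by rewrite fconsS; exact: A'x.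
  by rewrite fcons0; exact: Aa0.
have /choice[f fP] r : exists fr, (linear_on iota Y fr /\
    forall x, (forall i, A' i (x i)) -> fr (\prod_i x i) = phi (fcons (a0 ^+ r) x)) /\
    forall g, (linear_on iota Y g /\ forall x, (forall i, A' i (x i)) ->
      g (\prod_i x i) = phi (fcons (a0 ^+ r) x)) -> forall x, Y x -> fr x = g x.
  by have [fr fr1 fr2] := IH _ _ (phiS r); exists fr.
have f_lin r : linear_on iota Y (f r) by case: (fP r) => -[].
have fE r x : (forall i, A' i (x i)) ->
    f r (\prod_i x i) = phi (fcons (a0 ^+ r) x).
  by case: (fP r) => -[_ h] _; exact: h.
pose cr := coords p Y e a0; pose q := (p ^ e.+1)%N.
have crP x : adjoin F (range a) x -> [/\ forall i, Y (cr x)`_i,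
    (size (cr x) <= q)%N & x = (cr x).[a0]].
  by rewrite TE; exact: coordsP.
have YaY : Y `<=` adjoin F (range a) by rewrite TE; exact: sub_adjoin.
have prodE (x : 'I_n.+1 -> R) : \prod_i x i = x ord0 * \prod_i x (lift ord0 i).
  exact: big_ord_recl.
exists (fun x => \sum_(r < q) f r (cr x)`_r); first split.
- move=> c x y Tx Ty; rewrite scaler_sumr -big_split; apply: eq_bigr => r _ /=.
  rewrite /cr (coords_linear char_p sfY Ya0 nYa0) -?TE //; last by apply: FY; exact: in_range.
  rewrite coefD coefZ f_lin //; last by have [] := crP y Ty.
  by have [] := crP x Tx.
- move=> x Ax; pose x' i := x (lift ord0 i).
  have A'x i : A' i (x' i) by exact: Ax.
  have Fa0 : F (a0 ^+ q) by case: bG => Ge _; apply: Ge; exists a0.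
  have [Q [QF szQ xQ]] := adjoin1P char_p sfF Fa0 (Ax ord0).
  have /choice[c cE] r : exists c, Q`_r = iota c by have [c _ <-] := QF r; exists c.
  have Yx' : Y (\prod_i x' i).
    apply: (subfield_prod sfY) => i _.
    by have := A'x i; apply: adjoinS => _ ->; exists i.
  have -> : cr (\prod_i x i) = (\prod_i x' i) *: Q.
    apply: (coordsE char_p sfY Ya0 nYa0).
    - by move=> i; rewrite coefZ; apply: (subfieldM sfY) => //; apply: FY; exact: QF.
    - by rewrite (leq_trans (size_scale_leq _ _)).
    - by rewrite hornerZ -xQ prodE mulrC.
  rewrite [in RHS](fcons_eta x) xQ (horner_coef_wide _ szQ).
  under [in RHS]eq_bigr do rewrite cE.
  have sfA0 := adjoin_subfield F [set a ord0].
  rewrite (linear_on_sum sfA0 (@sub_adjoin _ _ _) (phi0 _ A'x)); last first.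
    by move=> r; exact: Aa0.
  apply: eq_bigr => r _; rewrite -fE // coefZ cE mulrC.
  by rewrite (linear_onZ sfY (f_lin r)).
- move=> g [g_lin gE] x Tx; have [Yx szx xE] := crP _ Tx.
  (* The map y |-> g(y a_0^r) also factors phi(a_0^r, -), so it is f_r by the uniqueness part of the
     induction hypothesis. *)
  have fg (r : nat) y : Y y -> f r y = g (y * a0 ^+ r).
    case: (fP r) => _ uniq; apply: (uniq (fun y => g (y * a0 ^+ r))); split.
      move=> c u v Yu Yv; rewrite mulrDl -mulrA; apply: g_lin.
        by apply: (subfieldM sfT); [exact: YaY|apply: (subfieldX sfT); apply: mem_adjoin; exists ord0].
      by apply: (subfieldM sfT); [exact: YaY|apply: (subfieldX sfT); apply: mem_adjoin; exists ord0].
    move=> u A'u; rewrite -gE; last first.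
      move=> i; case: (unliftP ord0 i) => [j|] ->; first by rewrite fconsS; exact: A'u.
      by rewrite fcons0; exact: Aa0.
    rewrite prodE fcons0 mulrC; congr (g (_ * _)).
    by apply: eq_bigr => i _; rewrite fconsS.
  rewrite [in RHS]xE (horner_coef_wide _ szx).
  have -> : \sum_(r < q) (cr x)`_r * a0 ^+ r =
      \sum_(r < q) iota 1 * ((cr x)`_r * a0 ^+ r).
    by apply: eq_bigr => r _; rewrite rmorph1 mul1r.
  rewrite (linear_on_sum sfT (@sub_adjoin _ _ _) g_lin).
    by apply: eq_bigr => r _; rewrite scale1r fg.
  move=> r; apply: (subfieldM sfT); first exact: YaY.
  by apply: (subfieldX sfT); apply: mem_adjoin; exists ord0.
Qed.
End TensorProduct.

Section ScalarRestriction.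
Variables (k R : fieldType) (iota : {rmorphism k -> R}).

(** A copy of R carrying the k-module structure given by [iota], so that R can be a target in the
    universal property of the tensor product. *)
Definition restr_scalars (_ : {rmorphism k -> R}) : Type := R.

HB.instance Definition _ := GRing.Zmodule.copy (restr_scalars iota) R.

Let scale (c : k) (x : restr_scalars iota) : restr_scalars iota :=
  iota c * (x : R).

Let scaleA c d x : scale c (scale d x) = scale (c * d) x.
Proof. by rewrite /scale rmorphM mulrA. Qed.
Let scale1 x : scale 1 x = x.
Proof. by rewrite /scale rmorph1 mul1r. Qed.
Let scaleDr c x y : scale c (x + y) = scale c x + scale c y.
Proof. exact: mulrDr. Qed.
Let scaleDl x c d : scale (c + d) x = scale c x + scale d x.
Proof. by rewrite /scale rmorphD mulrDl. Qed.

HB.instance Definition _ := GRing.Zmodule_isLmodule.Build k (restr_scalars iota)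
  scaleA scale1 scaleDr scaleDl.

Lemma restr_scaleE (c : k) (x : restr_scalars iota) : c *: x = iota c * (x : R).
Proof. by []. Qed.
End ScalarRestriction.

Section Equiexponential.
Variables (k R : fieldType) (iota : {rmorphism k -> R}).
Variables (p : nat) (char_p : p \in [pchar R]).
Implicit Types (A B F G K T : set R).

Local Notation F := (range iota).
Let sfF : is_subfield F := subfield_range iota.

Lemma finite_tupleP (s : seq R) : exists (n : nat) (a : 'I_n -> R),
  injective a /\ range a = [set` s].
Proof.
pose t := in_tuple (undup s); exists (size (undup s)), (tnth t); split.
  by apply/tuple_uniqP; exact: undup_uniq.
apply/seteqP; split=> [_ [i _ <-]|x /=].
  by have := mem_tnth i t; rewrite /= mem_undup.
by rewrite -mem_undup => /(tnthP t)[i ->]; exists i.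
Qed.

Lemma tensor_decomposition_adjoin G :
  adjoin F G = \bigcup_(n in [set: nat])
    \bigcup_(a in [set a : 'I_n -> R | injective a /\ range a `<=` G])
      adjoin F (range a).
Proof.
apply/seteqP; split=> [x /adjoin_finite[s sG sx]|x [n _ [a [_ aG]]]]; last first.
  exact: adjoinS.
have [n [a [a_inj as_]]] := finite_tupleP s.
by exists n => //; exists a; rewrite /= ?as_.
Qed.

Lemma equi_basis_equiexponential e G : equi_basis p F e G -> G !=set0 ->
  equiexponential iota p (adjoin F G) e.+1.
Proof.
move=> bG [g0 Gg0]; have [Ge iG] := bG.
have expK := powers_adjoin_exponent char_p sfF Ge.
have Gorder g : G g -> has_order p F g e.+1.
  move=> Gg; split=> [|m gm]; first by apply: Ge; exists g.
  rewrite ltnNge; apply/negP => me; apply: (iG (g ^+ (p ^ e))); first by exists g.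
  apply: sub_adjoin; rewrite -(subnKC me) expnD exprM.
  exact: subfieldX.
have GK := @mem_adjoin _ F G.
split.
- split=> [||x Kx]; [exact: adjoin_subfield|exact: sub_adjoin|].
  by exists e.+1; apply: expK; exists x.
- split=> [|m Km]; first exact: expK.
  by have [_] := Gorder _ Gg0; apply; apply: Km; exists g0 => //; exact: GK.
- exists G; split=> //; last first.
    split; first exact: tensor_decomposition_adjoin.
    by move=> n a a_inj aG; exact: (tensor_equi_basis char_p bG).
  have sfK := adjoin_subfield F G; split=> //.
    apply/seteqP; split; first by apply: adjoinSl; exact: sub_adjoin.
    apply: adjoin_min => //; apply: adjoin_min => //; first exact: sub_adjoin.
    exact: (@powers_sub _ _ 1).
  (* F(K^p) lies in the field of p^e-th roots of F, over which G is still independent. *)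
  move=> x Gx; apply: contra_not (rindep_roots char_p iG Gx).
  apply: adjoinSl; apply: adjoin_min; first exact: subfield_roots.
    by move=> y Fy; exact: subfieldX.
  move=> _ [y Ky <-]; rewrite /roots /= -exprM -expnS.
  by apply: expK; exists y.
Qed.

(* The universal property applied to x |-> la(x_0) x_1 ... x_n, where la is the
   coefficient of g^(p^e), gives a linear f.  The y such that f(x y) = y f(x) for
   all x form a subfield containing the b_i, on which f vanishes since
   la(1) = 0; but f(g^(p^e)) = 1. *)
Lemma equiexponential_equi_basis e K : equiexponential iota p K e.+1 ->
  exists2 G, equi_basis p F e G & K = adjoin F G.
Proof.
move=> [_ _ [G [_ [KE tG] oG]]]; exists G; last first.
  by rewrite KE tensor_decomposition_adjoin.
split=> [_ [g Gg <-]|]; first by case: (oG g Gg).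
move=> _ [g Gg <-]; rewrite -(powersD1 char_p) => gF.
have {gF} : adjoin F (G `\ g) (g ^+ (p ^ e)).
  move: gF; apply: adjoin_mono; first exact: sub_adjoin.
  move=> _ [x Gx <-]; apply: (subfieldX (adjoin_subfield _ _)).
  exact: mem_adjoin.
move=> /adjoin_finite[s sG]; have [n [b [b_inj bs]]] := finite_tupleP s.
rewrite -bs in sG *; set y := g ^+ (p ^ e) => yb.
pose a := fcons g b.
have a_inj : injective a.
  move=> i j; rewrite /a; case: (unliftP ord0 i) => [i'|] ->;
    case: (unliftP ord0 j) => [j'|] ->; rewrite ?fconsS ?fcons0 //.
  - by move=> /b_inj ->.
  - by move=> bg; have [_ []] : (G `\ g) (b i') by apply: sG; exists i'.
  - by move=> bg; have [_ []] : (G `\ g) (b j') by apply: sG; exists j'.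
have aG : range a `<=` G.
  by rewrite /a range_fcons => x [/sG[]//|->].
have Fgq : F (g ^+ (p ^ e.+1)) by have [] := oG g Gg.
have nFg : ~ F (g ^+ (p ^ e)) by move=> Fgy; have [_ /(_ _ Fgy)] := oG g Gg; rewrite ltnn.
have [_ univ] := tG _ a a_inj aG.
set T := adjoin F (range a) in univ; have sfT : is_subfield T := adjoin_subfield _ _.
pose A i := adjoin F [set a i].
have A0 : A ord0 = adjoin F [set g] by rewrite /A /a fcons0.
pose la x := (coords p F e g x)`_(p ^ e).
have la_lin c x z : A ord0 x -> A ord0 z -> la (iota c * x + z) = iota c * la x + la z.
  rewrite A0 => Ax Az; rewrite /la.
  by rewrite (coords_linear char_p sfF Fgq nFg (in_range iota c) Ax Az) coefD coefZ.
have la1 : la 1 = 0.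
  rewrite /la (coordsE (P := 1) char_p sfF Fgq nFg) ?hornerC //.
  - by rewrite coef1 expn_eq0 eqn0Ngt prime_gt0 ?(pcharf_prime char_p).
  - by move=> i; rewrite coef1; case: eqP => _; [exact: subfield1|exact: subfield0].
  - by rewrite size_poly1 expn_gt0 prime_gt0 ?(pcharf_prime char_p).
have lay : la y = 1.
  rewrite /la (coordsE (P := 'X^(p ^ e)) char_p sfF Fgq nFg) ?hornerXn //.
  - by rewrite coefXn eqxx.
  - by move=> i; rewrite coefXn; case: eqP => _; [exact: subfield1|exact: subfield0].
  - by rewrite size_polyXn ltn_exp2l // prime_gt1 ?(pcharf_prime char_p).
pose phi (x : 'I_n.+1 -> R) : restr_scalars iota :=
  la (x ord0) * \prod_i x (lift ord0 i).
have phiE u (v : 'I_n -> R) : phi (fcons u v) = la u * \prod_i v i.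
  by rewrite /phi fcons0; under eq_bigr do rewrite fconsS.
have prod_with i (v : 'I_n -> R) w :
    \prod_j [eta v with i |-> w] j = w * \prod_(j | j != i) v j.
  rewrite (bigD1 i) //= eqxx; congr (_ * _).
  by apply: eq_bigr => j /negPf ->.
have phi_lin : multilinear_on iota A phi.
  move=> i x u v c Ax; rewrite (fcons_eta x); case: (unliftP ord0 i) => [j|] -> Au Av.
    rewrite !fcons_withS !phiE !prod_with restr_scaleE.
    by rewrite mulrDl mulrDr; congr (_ + _); ring.
  rewrite !fcons_with0 !phiE restr_scaleE la_lin // mulrDl.
  by congr (_ + _); rewrite mulrA.
have [f [f_lin fE] _] := univ _ _ phi_lin.
have f0 := linear_on0 sfT f_lin.
have fZ := linear_onZ sfT f_lin.
have b_scale i x : T x -> f (x * b i) = b i * (f x : R).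
  (* The maps x |-> f(x b_i) and x |-> b_i f(x) both factor psi, so they agree on T by
     uniqueness. *)
  pose psi (x : 'I_n.+1 -> R) : restr_scalars iota := b i * (phi x : R).
  have psi_lin : multilinear_on iota A psi.
    move=> j z u v c Az Au Av; rewrite /psi phi_lin // !restr_scaleE.
    by rewrite mulrDr mulrCA.
  have Tb : T (b i) by apply: mem_adjoin; exists (lift ord0 i) => //; rewrite /a fconsS.
  have [h _ uniq] := univ _ _ psi_lin.
  have h1 : forall z, T z -> h z = f (z * b i).
    apply: uniq; split=> [c u v Tu Tv|z Az].
      by rewrite mulrDl -mulrA; apply: f_lin; exact: (subfieldM sfT).
    pose z' (j : 'I_n) := if j == i then z (lift ord0 j) * b i else z (lift ord0 j).
    have prodz' : \prod_j z' j = \prod_j z (lift ord0 j) * b i.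
      rewrite (bigD1 i) //= [in RHS](bigD1 i) //= {1}/z' eqxx mulrAC.
      by congr (_ * _ * _); apply: eq_bigr => j /negPf ji; rewrite /z' ji.
    have -> : \prod_j z j * b i = \prod_j fcons (z ord0) z' j.
      rewrite !big_ord_recl fcons0 -mulrA -prodz'; congr (_ * _).
      by apply: eq_bigr => j _; rewrite fconsS.
    rewrite fE.
      by rewrite phiE prodz' /psi /phi mulrA mulrC.
    move=> j; case: (unliftP ord0 j) => [l|] ->; last by rewrite fcons0; exact: Az.
    rewrite fconsS /z'; case: eqP => [->|_]; last exact: Az.
    apply: (subfieldM (adjoin_subfield _ _)); first exact: Az.
    by apply: mem_adjoin; rewrite /= /a fconsS.
  have h2 : forall z, T z -> h z = b i * (f z : R).
    apply: uniq; split=> [c u v Tu Tv|z Az]; last by rewrite fE.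
    by rewrite f_lin // restr_scaleE mulrDr mulrCA.
  by move=> Tx; rewrite -h1 // h2.
pose Z := [set z | T z /\ forall x, T x -> f (x * z) = z * (f x : R)].
have bZ : adjoin F (range b) `<=` Z.
  apply: adjoin_min; first apply: subfieldP.
  - by split=> [|x Tx]; [exact: (subfield1 sfT)|rewrite mulr1 mul1r].
  - move=> u v [Tu fu] [Tv fv]; split=> [|x Tx]; first exact: (subfieldB sfT).
    have -> : x * (u - v) = iota (-1) * (x * v) + x * u.
      by rewrite rmorphN1; ring.
    rewrite f_lin; [|exact: (subfieldM sfT)|exact: (subfieldM sfT)].
    by rewrite fu // fv // restr_scaleE rmorphN1 mulN1r mulrBl addrC.
  - move=> u v [Tu fu] [Tv fv]; split=> [|x Tx]; first exact: (subfield_div sfT).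
    have [->|v0] := eqVneq v 0; first by rewrite invr0 !mulr0 mul0r.
    apply: (mulfI v0); rewrite -fv; last by apply: (subfieldM sfT) => //; exact: (subfield_div sfT).
    have -> : x * (u / v) * v = x * u by rewrite -!mulrA mulVf ?mulr1.
    by rewrite fu // [RHS]mulrA [v * _]mulrC divfK.
  - move=> _ [c _ <-]; split=> [|x Tx]; first by apply: sub_adjoin; exists c.
    by rewrite mulrC fZ.
  - move=> _ [i _ <-]; split=> [|x Tx]; last exact: b_scale.
    by apply: mem_adjoin; exists (lift ord0 i) => //; rewrite /a fconsS.
have [_ /(_ 1 (subfield1 sfT))] := bZ _ yb.
have prod1 (u : R) : \prod_i fcons u (fun _ : 'I_n => 1) i = u.
  by rewrite big_ord_recl fcons0; under eq_bigr do rewrite fconsS; rewrite big1 // mulr1.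
have A1 u : A ord0 u -> forall i, A i (fcons u (fun=> 1) i).
  move=> Au i; case: (unliftP ord0 i) => [j|] ->; last by rewrite fcons0.
  by rewrite fconsS; exact: (subfield1 (adjoin_subfield _ _)).
have fu u : A ord0 u -> f u = la u.
  move=> Au; rewrite -[in LHS](prod1 u) fE; last exact: A1.
  by rewrite phiE big1 // mulr1.
rewrite mul1r !fu.
- by rewrite la1 lay mulr0 => /eqP; rewrite oner_eq0.
- exact: (subfield1 (adjoin_subfield _ _)).
- by rewrite A0; apply: (subfieldX (adjoin_subfield _ _)); exact: mem_adjoin.
Qed.
End Equiexponential.

(** * Linear disjointness *)

Section LinearDisjointness.
Variables (R : fieldType) (p : nat) (char_p : p \in [pchar R]).
Implicit Types (A B C F G H K L M S T U V W : set R) (x y : R).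

Lemma lin_span_sum F n (e : 'I_n -> R) (I : eqType) (s : seq I) (f : I -> R) :
  is_subfield F -> (forall i, i \in s -> lin_span F e (f i)) ->
  lin_span F e (\sum_(i <- s) f i).
Proof.
move=> sfF fe; rewrite big_seq; elim/big_ind: _ => //.
- exists (fun=> 0) => [_|]; first exact: subfield0.
  by rewrite big1 // => i _; rewrite mul0r.
- move=> _ _ [c Fc ->] [d Fd ->]; exists (fun i => c i + d i) => [i|].
    exact: subfieldD.
  by rewrite -big_split; apply: eq_bigr => i _; rewrite mulrDl.
Qed.

Lemma lin_spanZ F n (e : 'I_n -> R) c x : is_subfield F -> F c ->
  lin_span F e x -> lin_span F e (c * x).
Proof.
move=> sfF Fc [d Fd ->]; exists (fun i => c * d i) => [i|].
  exact: subfieldM.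
by rewrite mulr_sumr; apply: eq_bigr => i _; rewrite mulrA.
Qed.

Lemma lin_span_subset F F' n (e : 'I_n -> R) : F `<=` F' ->
  lin_span F e `<=` lin_span F' e.
Proof. by move=> FF' _ [c Fc ->]; exists c => // i; exact: FF'. Qed.

Lemma lin_span_sub F V n (e : 'I_n -> R) : is_subfield V -> F `<=` V ->
  (forall i, V (e i)) -> lin_span F e `<=` V.
Proof.
move=> sfV FV Ve _ [c Fc ->]; apply: subfield_sum => // i _.
by apply: subfieldM => //; exact: FV.
Qed.

Lemma lin_indep_powers n A m (e : 'I_m -> R) : lin_indep A e ->
  lin_indep (powers (p ^ n) A) (fun i => e i ^+ (p ^ n)).
Proof.
move=> eA c cA ce; have /choice[d dP] i : exists d, A d /\ c i = d ^+ (p ^ n).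
  by have [d Ad <-] := cA i; exists d.
have /eA d0 : \sum_i d i * e i = 0.
  apply: (expr_p_inj char_p (n := n)).
  rewrite -[LHS]/(frobenius char_p n _) rmorph_sum /= expr0n expn_eq0.
  rewrite eqn0Ngt prime_gt0 ?(pcharf_prime char_p) //= -[RHS]ce.
  by apply: eq_bigr => i _; rewrite /frobenius exprMn; have [_ ->] := dP i.
move=> i; have [_ ->] := dP i; rewrite d0 => [|j]; last by have [] := dP j.
by rewrite expr0n expn_eq0 eqn0Ngt prime_gt0 ?(pcharf_prime char_p).
Qed.

(** The coefficients of a relation among elements of A are expanded on elements e_j of F independent
    over A \cap F, hence over A, with coefficients in B. Comparing the coefficients of each e_j
    gives relations over B. *)
Lemma compositum_lin_disjoint F A B :
  is_subfield F -> is_subfield A -> is_subfield B ->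
  A `&` F `<=` B -> B `<=` A -> lin_disjoint F A (A `&` F) ->
  (forall y, B y -> exists n, F (y ^+ (p ^ n))) ->
  lin_disjoint A (adjoin F B) B.
Proof.
move=> sfF sfA sfB AFB BA dFA Bp n x Ax xB la Fla la0.
have sfC := subfield_setI sfA sfF.
have /choice[s sP] i : exists s : seq (R * R),
    (forall z, z \in s -> F z.1 /\ B z.2) /\ la i = \sum_(z <- s) z.1 * z.2.
  by have [s] := compositum_sum char_p sfF sfB Bp (Fla i); exists s.
pose t := in_tuple (flatten [seq s i | i <- enum 'I_n]).
have tF i : F (tnth t i).1.
  have /flattenP[_ /mapP[j _ ->] tj] := mem_tnth i t.
  by have [/(_ _ tj)[]] := sP j.
have [m [e [_ [_ eC Fe et]]]] := extract_basis sfC (subfield1 sfF) tF.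
have eA := dFA _ _ Fe eC.
have /lin_span_choice[g gB gE] i : lin_span B e (la i).
  have [sFB ->] := sP i; apply: lin_span_sum => // z zs.
  rewrite mulrC; apply: lin_spanZ => //; first by have [] := sFB _ zs.
  apply: (lin_span_subset AFB).
  have /(tnthP t)[j ->] // : z \in flatten [seq s i | i <- enum 'I_n].
  by apply/flattenP; exists (s i) => //; rewrite map_f // mem_enum.
have gx j : \sum_i g i j * x i = 0.
  apply: (eA (fun j => \sum_i g i j * x i)) => [{}j|].
    by apply: subfield_sum => // i _; apply: subfieldM => //; exact: BA.
  rewrite -[RHS]la0; under [RHS]eq_bigr do rewrite gE mulr_suml.
  rewrite exchange_big /=; apply: eq_bigr => l _; rewrite mulr_suml.
  by apply: eq_bigr => i _; rewrite mulrAC.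
by move=> i; rewrite gE big1 // => j _; rewrite (xB _ _ (gx j)) ?mul0r.
Qed.

Hypothesis perfectR : forall n (x : R), exists y, y ^+ (p ^ n) = x.

Lemma powers_roots n F : powers (p ^ n) (roots (p ^ n) F) = F.
Proof.
apply/seteqP; split=> [_ [x Fx <-]//|x Fx].
by have [y yx] := perfectR n x; exists y; rewrite // /roots /= yx.
Qed.

(* With T = roots (p ^ e) F, both T(U) = T(V) and the linear disjointness of V
   and T over F(V^p) give V = F(V^p)(U); iterating, V = F(V^(p^i))(U). *)
Lemma equi_basis_socle_sub F e G H : is_subfield F ->
  equi_basis p F e G -> equi_basis p F e H -> adjoin F G `<=` adjoin F H ->
  (forall x, adjoin F H x -> F (x ^+ p) -> adjoin F G x) ->
  adjoin F H `<=` adjoin F G.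
Proof.
move=> sfF bG [He iH]; set U := adjoin F G; set V := adjoin F H => UV socV.
have sfU : is_subfield U := adjoin_subfield _ _.
have sfV : is_subfield V := adjoin_subfield _ _.
have VF : powers (p ^ e.+1) V `<=` F := powers_adjoin_exponent char_p sfF He.
pose T := roots (p ^ e) F; have sfT : is_subfield T by exact: subfield_roots.
have FT : F `<=` T by move=> x Fx; exact: subfieldX.
pose S := adjoin F (powers (p ^ 1) V); have sfS : is_subfield S := adjoin_subfield _ _.
have SV : S `<=` V.
  by apply: adjoin_min => //; [exact: sub_adjoin|exact: powers_sub].
have ST : S `<=` T.
  apply: adjoin_min => //; apply: (powers_rootsS _ _ _ _).1.
  by rewrite powers_powers add1n.
have VE : V = adjoin S H.
  apply/seteqP; split; first by apply: adjoinSl; exact: sub_adjoin.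
  by apply: adjoin_min => //; exact: mem_adjoin.
have dTV : lin_disjoint T V S.
  rewrite VE; apply: (equi_basis_lin_disjoint char_p (e := 0)) => //.
    apply: subset_trans (@mem_adjoin _ _ _); apply: powersS.
    exact: mem_adjoin.
  by rewrite powers0; exact: rindep_roots.
pose W := adjoin S U; have sfW : is_subfield W := adjoin_subfield _ _.
have WV : W `<=` V by exact: adjoin_min.
have VW : V `<=` W.
  (* After raising to the power p^e, the claim is that x^(p^e) is in F(G^(p^e)): its p-th power is
     in F, so it lies in U by the hypothesis on V, and [socle] applies. *)
  move=> x Vx; have TUx : adjoin T U x.
    apply: (@adjoinS _ _ G); first exact: mem_adjoin.
    rewrite -(powers_mem char_p e) (powers_adjoin char_p) powers_roots.
    have xF : F (x ^+ (p ^ e) ^+ p).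
      by rewrite -exprM -expnSr; apply: VF; exists x.
    apply: (socle char_p (m := 0)); rewrite ?addn0 //.
    by apply: socV => //; exact: (subfieldX sfV).
  have Up y : U y -> exists n, T (y ^+ (p ^ n)).
    by move=> /UV Vy; exists e.+1; apply: FT; apply: VF; exists y.
  have [n [t [y [i0 [ti0 Tt tV Wy xE]]]]] :=
    compositum_expand char_p sfT sfS sfW sfU (@sub_adjoin _ S U)
      (@mem_adjoin _ S U) dTV Up TUx.
  (* Since t_i0 = 1, x has two expansions over V on the t_i, which are independent over V: the
     trivial one, and the one with coefficients y_i. *)
  suff -> : x = y i0 by [].
  have /tV/(_ i0)/eqP : \sum_i (y i - (if i == i0 then x else 0)) * t i = 0.
    under eq_bigr do rewrite mulrBl; rewrite sumrB -xE (bigD1 i0) //= eqxx ti0.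
    rewrite mulr1 big1 ?addr0 ?subrr // => i /negPf ->.
    by rewrite mul0r.
  rewrite eqxx subr_eq0 => /(_ _)/eqP -> // i.
  apply: (subfieldB sfV); first exact: WV.
  by case: ifP => // _; exact: (subfield0 sfV).
have VS i : V `<=` adjoin F (powers (p ^ i) V `|` U).
  elim: i => [|i IHi]; first by rewrite powers0 => x Vx; apply: mem_adjoin; left.
  apply: subset_trans IHi _; apply: adjoin_mono; first exact: sub_adjoin.
  move=> x [|Ux]; last by apply: mem_adjoin; right.
  move=> /(powersS VW); rewrite /W adjoinU (powers_adjoin char_p).
  apply: adjoin_mono.
    by apply: subset_trans (@sub_adjoin _ _ _); exact: powers_sub.
  move=> _ [y [Vy|Uy] <-]; apply: mem_adjoin; [left|right].
    by rewrite -add1n -powers_powers; exists y.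
  exact: (subfieldX sfU).
apply: subset_trans (VS e.+1) _; apply: adjoin_min => //; first exact: sub_adjoin.
move=> x [/VF Fx|//]; exact: sub_adjoin.
Qed.

End LinearDisjointness.

(** * The stable socle of an extension of unbounded exponent *)

Section StableSocle.
Variables (R : fieldType) (p : nat) (char_p : p \in [pchar R]).
Variables (F K L : set R).
Hypotheses (sfF : is_subfield F) (sfK : is_subfield K) (sfL : is_subfield L).
Hypotheses (FL : F `<=` L) (LK : L `<=` K).
Hypothesis K_insep : forall x, K x -> exists n, F (x ^+ (p ^ n)).
Hypothesis K_modular : modular p F K.

Let socle_part m : set R :=
  roots p F `&` L `&` adjoin F (powers (p ^ m) L).

Let socle_part_subfield m : is_subfield (socle_part m).
Proof.
apply: subfield_setI; last exact: adjoin_subfield.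
by apply: subfield_setI => //; exact: (subfield_roots char_p 1).
Qed.

Let sub_socle_part m : F `<=` socle_part m.
Proof.
by move=> x Fx; split; [split; [exact: subfieldX|exact: FL]|exact: sub_adjoin].
Qed.

Let socle_part_le m n : (m <= n)%N -> socle_part n `<=` socle_part m.
Proof.
move=> mn x [FLx Lx]; split=> //; move: Lx; apply: adjoinS.
exact: powers_le.
Qed.

(** Let d be the largest number such that every member of the decreasing sequence contains d
    elements independent over F, and m0 an index where d + 1 fails. For m >= m0, any d independent
    elements of the m-th member span the one of index m0. *)
Lemma socle_part_stable N :
  (forall m (x : 'I_m -> R), (forall i, (roots p F `&` L) (x i)) ->
    lin_indep F x -> (m <= N)%N) ->
  exists m0, (exists d, has_degree F (socle_part m0) d) /\
    forall m, socle_part m0 `<=` socle_part m.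
Proof.
move=> dimN; pose free d m := exists e : 'I_d -> R,
  (forall i, socle_part m (e i)) /\ lin_indep F e.
pose A d := `[< forall m, free d m >].
have A0 : exists d, A d.
  by exists 0%N; apply/asboolP => m; exists (fun=> 0); split=> [[]|c _ _ []].
have AN d : A d -> (d <= N)%N.
  by move=> /asboolP/(_ 0%N)[e [Qe]]; apply: dimN => i; have [] := Qe i.
case: (ex_maxnP A0 AN) => d /asboolP Ad dmax.
have [m0 nfree] : exists m0, ~ free d.+1 m0.
  apply: contrapT => /forallNP h; have : A d.+1.
    by apply/asboolP => m; apply: contrapT; exact: h.
  by move=> /dmax; rewrite ltnn.
have span m e : (forall i, socle_part m (e i)) -> lin_indep F e ->
    (m0 <= m)%N -> socle_part m0 `<=` @lin_span R F d e.
  move=> Qe ei m0m x Qx; apply: contrapT => xe; apply: nfree.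
  exists (fcons x e); split; last exact: lin_indep_cons.
  by apply: fconsP => // i; exact: (socle_part_le m0m).
exists m0; split.
  have [e [Qe ei]] := Ad m0; exists d, e; split=> // x Qx.
  exact: (span m0 e).
move=> m; have [e [Qe ei]] := Ad (maxn m0 m).
apply: subset_trans (span _ e Qe ei (leq_maxl _ _)) _.
apply: subset_trans (socle_part_le (leq_maxr m0 m)).
exact: lin_span_sub.
Qed.

Lemma lin_disjoint_powers m : lin_disjoint F (powers (p ^ m) K) (powers (p ^ m) K `&` F).
Proof.
have sfA := subfield_powers char_p m sfK.
apply: (lin_disjointC sfA sfF _ _ (@K_modular m)); first exact: subfield_setI.
by move=> x [].
Qed.

(** For j < n, the core is that Q is generated over F by those of its elements that are p^j-th
    powers in M; [compositum_lin_disjoint] then deduces linear disjointness over Q from modularity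
    over F. *)
Lemma socle_part_modular m0 n M : (forall m, socle_part m0 `<=` socle_part m) ->
  is_subfield M -> M `<=` K -> powers (p ^ n) M `<=` F ->
  K `&` roots (p ^ n) F `<=` M -> modular p (socle_part m0) M.
Proof.
move=> stable sfM MK Mn KM j; set Q := socle_part m0 in stable *.
have sfQ : is_subfield Q := socle_part_subfield m0.
have FQ : F `<=` Q := @sub_socle_part m0.
set A := powers (p ^ j) M; have sfA : is_subfield A by exact: subfield_powers.
have [nj|jn] := leqP n j.
  by apply: lin_disjoint_sub => //; apply: subset_trans FQ; apply: powers_le_sub Mn.
pose AK := powers (p ^ j) K; have sfAK : is_subfield AK by exact: subfield_powers.
have QB : Q = adjoin F (A `&` Q).
  apply/seteqP; split; last by apply: adjoin_min => // x [].
  (* By stability x lies in F(L^(p^m)). The choice m >= m0 keeps the coefficients in F(L^(p^m0)),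
     and m >= n leaves room to extract p^j-th roots inside K. *)
  move=> x Qx; pose m := (m0 + n)%N; pose A' := powers (p ^ m) K.
  have sfA' : is_subfield A' by exact: subfield_powers.
  have Lm x' : powers (p ^ m) L x' -> exists n, F (x' ^+ (p ^ n)).
    by move=> [z Lz <-]; apply: K_insep; apply: (subfieldX sfK); exact: LK.
  pose W := A' `&` (L `&` adjoin F (powers (p ^ m0) L)).
  have sfW : is_subfield W.
    by do 2! [apply: subfield_setI => //]; exact: adjoin_subfield.
  have A'W : A' `&` F `<=` W.
    by move=> z [A'z Fz]; split=> //; split; [exact: FL|exact: sub_adjoin].
  have LW : powers (p ^ m) L `<=` W.
    move=> z Lz; split; first by move: Lz; exact: powersS.
    split; first by move: Lz; exact: powers_sub.
    by apply: mem_adjoin; move: Lz; apply: powers_le => //; exact: leq_addr.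
  have sfC := subfield_setI sfA' sfF.
  have [[_ _] FLx] := stable m x Qx.
  have [l [e [y [_ [_ Fe eA' Wy xE]]]]] := compositum_expand char_p sfF sfC sfW
    (subfield_powers char_p m sfL) A'W LW (@lin_disjoint_powers m) Lm FLx.
  (* Frobenius carries the expansion of x to one of x^p on the e_i^p, which are independent over
     K^(p^(m+1)); as x^p is in F, [coefs_in_subfield] puts the y_i^p in F. *)
  have Fy i : F (y i ^+ p).
    pose A'' := powers (p ^ 1) A'; have sfA'' : is_subfield A'' by exact: subfield_powers.
    have dA'' : lin_disjoint F A'' (A'' `&` F).
      rewrite /A'' /A' powers_powers; exact: lin_disjoint_powers.
    apply: (coefs_in_subfield sfA'' sfF dA'' (e := fun i => e i ^+ (p ^ 1))
      (y := fun i => y i ^+ (p ^ 1))) i.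
    - by move=> i; apply: subfieldX.
    - exact: (lin_indep_powers char_p).
    - by move=> i; exists (y i) => //; have [] := Wy i.
    - have -> : \sum_i y i ^+ (p ^ 1) * e i ^+ (p ^ 1) = x ^+ p.
        rewrite xE -[RHS]/(frobenius char_p 1 _) rmorph_sum.
        by apply: eq_bigr => i _; rewrite /= /frobenius exprMn.
      by have [[]] := Qx.
  rewrite xE; apply: (subfield_sum (adjoin_subfield _ _)) => i _.
  apply: (subfieldM (adjoin_subfield _ _)); last exact: sub_adjoin.
  apply: mem_adjoin; have [[z Kz zy] [Ly FLy]] := Wy i; split; last by split=> //; split=> //; exact: Fy.
  exists (z ^+ (p ^ (m - j))); last first.
    by rewrite -exprM -expnD subnK ?zy // (leq_trans (ltnW jn)) // leq_addl.
  apply: KM; split; first exact: (subfieldX sfK).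
  (* Raising z^(p^(m-j)) to the power p^n passes through y_i = z^(p^m) with at least one p-th power
     to spare, since j < n; hence it lands in F. *)
  have mjn : (m - j + n = m.+1 + (n - j.+1))%N by rewrite /m; lia.
  rewrite /roots /= -exprM -expnD mjn expnD exprM expnSr exprM zy.
  exact: (subfieldX sfF).
have sfB := subfield_setI sfA sfQ.
rewrite {1}QB; have AAK : A `<=` AK by exact: powersS.
have BAK : A `&` Q `<=` AK by move=> x [/AAK].
have dAK : lin_disjoint AK (adjoin F (A `&` Q)) (A `&` Q).
  apply: (compositum_lin_disjoint char_p sfF sfAK sfB) => //.
  - move=> _ [[z Kz <-] Fz]; split; last exact: FQ.
    exists z => //; apply: KM; split=> //.
    by rewrite /roots /= -(subnKC (ltnW jn)) expnD exprM; exact: subfieldX.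
  - exact: lin_disjoint_powers.
  - by move=> y /BAK; move=> /(powers_sub sfK) /K_insep.
by move=> l x Ax; apply: dAK => i; exact: AAK.
Qed.
End StableSocle.

(** * The extension step *)

Section ExtensionStep.
Variables (R : fieldType) (p : nat) (char_p : p \in [pchar R]).
Implicit Types (A B C F G H L M N S T U V W Y : set R) (x y a t w : R).
Hypothesis perfectR : forall n (x : R), exists y, y ^+ (p ^ n) = x.

Let p_pr : prime p := pcharf_prime char_p.

Definition proots C : set R := roots p C.

Lemma powers_proots e C : powers (p ^ e.+1) (proots C) = powers (p ^ e) C.
Proof.
by rewrite -add1n -powers_powers (powers_roots perfectR 1).
Qed.

Lemma equi_basis_proots F e C :
  equi_basis p F e C -> equi_basis p F e.+1 (proots C).
Proof. by rewrite /equi_basis !powers_proots. Qed.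

Lemma sub_adjoin_proots F C : adjoin F C `<=` adjoin F (proots C).
Proof.
apply: adjoin_mono; first exact: sub_adjoin.
move=> x Cx; have [y yx] := perfectR 1 x; rewrite -yx.
by apply: (subfieldX (adjoin_subfield _ _)); apply: mem_adjoin; rewrite /proots /roots /= -[p]/(p ^ 1)%N yx.
Qed.

(** By [socle], such an x lies in F(C^(p^e)), as the p^(e+1)-th powers of the new generators are the
    p^e-th powers of C. This is why the extension step creates no new element with p-th power in
    F. *)
Lemma proots_socle F e C x : is_subfield F -> equi_basis p F e C ->
  adjoin F (proots C) x -> F (x ^+ p) -> adjoin F C x.
Proof.
move=> sfF bC Cx xp.
have : adjoin F (powers (p ^ e.+1) (proots C)) x.
  apply: (socle char_p (m := 0)) => //; rewrite addn0; exact: equi_basis_proots.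
rewrite powers_proots; apply: adjoin_mono; first exact: sub_adjoin.
move=> _ [y Cy <-]; apply: (subfieldX (adjoin_subfield _ _)).
exact: mem_adjoin.
Qed.

(* The new generator c satisfies c - w = (g - w) / t. *)
Definition twist G g w t : set R := (G `\ g) `|` [set w + (g - w) / t].

Section Twist.
Variables (F : set R) (e : nat) (G : set R) (g w t : R).
Hypotheses (sfF : is_subfield F) (bG : equi_basis p F e G) (Gg : G g).
Hypotheses (Gw : adjoin F (G `\ g) w) (Ft : F t) (t0 : t != 0).

Lemma adjoin_twist : adjoin F (twist G g w t) = adjoin F G.
Proof.
have GgG : adjoin F (G `\ g) `<=` adjoin F G by apply: adjoinS => x [].
have sfG := adjoin_subfield F G; have sfT := adjoin_subfield F (twist G g w t).
apply/seteqP; split; apply: adjoin_mono; try exact: sub_adjoin.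
  move=> x [[Gx _]|->]; first exact: mem_adjoin.
  apply: (subfieldD sfG); first exact: GgG.
  apply: (subfield_div sfG); last exact: sub_adjoin.
  by apply: (subfieldB sfG); [exact: mem_adjoin|exact: GgG].
have Tw : adjoin F (twist G g w t) w by move: Gw; apply: adjoinS => x; left.
move=> x Gx; have [->|xg] := pselect (x = g); last by apply: mem_adjoin; left.
have gE : g = w + t * (w + (g - w) / t - w) by field.
rewrite [X in adjoin _ _ X]gE.
apply: (subfieldD sfT) => //; apply: (subfieldM sfT); first exact: sub_adjoin.
by apply: (subfieldB sfT) => //; apply: mem_adjoin; right.
Qed.

Lemma frobenius_twist n : (w + (g - w) / t) ^+ (p ^ n) =
  w ^+ (p ^ n) + (g ^+ (p ^ n) - w ^+ (p ^ n)) / t ^+ (p ^ n).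
Proof.
rewrite -[LHS]/(frobenius char_p n _) rmorphD fmorph_div rmorphB.
by [].
Qed.

(** On p^e-th powers the change of generator is affine and invertible over the field generated by F
    and the p^e-th powers of the other generators, so independence is preserved. *)
Lemma equi_basis_twist : equi_basis p F e (twist G g w t).
Proof.
have [Ge iG] := bG.
have Te : powers (p ^ e.+1) (twist G g w t) `<=` F.
  apply: subset_trans (powers_adjoin_exponent char_p sfF Ge).
  by apply: powersS; rewrite -adjoin_twist; exact: mem_adjoin.
split=> //; set c := w + (g - w) / t; set B := powers (p ^ e) (G `\ g).
have -> : powers (p ^ e) (twist G g w t) = B `|` [set c ^+ (p ^ e)].
  by rewrite /powers image_setU image_set1.
have pE x : x ^+ (p ^ e) ^+ p = x ^+ (p ^ e.+1) by rewrite -exprM -expnSr.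
apply: (rindep_setU1 char_p sfF).
- by move=> _ [x [Gx _] <-]; rewrite pE; apply: Ge; exists x.
- by rewrite pE; apply: Te; exists c => //; right.
- by apply: rindepS iG; apply: powersS => x [].
have sfB := adjoin_subfield F B.
have Bw : adjoin F B (w ^+ (p ^ e)).
  have : powers (p ^ e) (adjoin F (G `\ g)) (w ^+ (p ^ e)) by exists w.
  by rewrite (powers_adjoin char_p); apply: adjoinSl; exact: powers_sub.
have gB : ~ adjoin F B (g ^+ (p ^ e)).
  by rewrite /B (powersD1 char_p); apply: iG; exists g.
apply: contra_not gB; rewrite frobenius_twist => Bc.
have Bt : adjoin F B (t ^+ (p ^ e)) by apply: sub_adjoin; exact: subfieldX.
have tn0 : t ^+ (p ^ e) != 0 by rewrite expf_neq0.
set z := (X in adjoin F B X) in Bc.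
have -> : g ^+ (p ^ e) = w ^+ (p ^ e) + t ^+ (p ^ e) * (z - w ^+ (p ^ e)).
  by rewrite /z; field.
apply: (subfieldD sfB) => //; apply: (subfieldM sfB) => //.
exact: (subfieldB sfB).
Qed.

End Twist.

Lemma deriv_neq0_small (P : {poly R}) : (1 < size P <= p)%N -> P^`() != 0.
Proof.
case/andP=> szP szp; apply/negP => /eqP/polyP/(_ (size P).-2).
rewrite coef_deriv coef0 prednK ?subn_gt0 -?subn1 ?subn_gt0 // subn1.
rewrite -mulr_natr => /eqP; rewrite mulf_eq0 -[P`__]/(lead_coef P) lead_coef_eq0.
rewrite -size_poly_eq0 -(dvdn_pcharf char_p) => /orP[/eqP P0|/dvdn_leq].
  by rewrite P0 in szP.
by lia.
Qed.

(** Euler's identity: it turns membership of every term Q_r u^r in a subfield into membership of u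
    Q'(u). *)
Lemma euler_horner (Q : {poly R}) u : (size Q <= p)%N ->
  \sum_(r < p) (Q`_r * u ^+ r) *+ r = u * Q^`().[u].
Proof.
move=> szQ; rewrite mulrC -hornerMX (@horner_coef_wide _ p); last first.
  apply/leq_sizeP => j pj; rewrite coefMX; case: eqP => // /eqP j0.
  by rewrite coef_deriv prednK ?lt0n // nth_default ?mul0rn // (leq_trans szQ).
apply: eq_bigr => -[[|r] rp] _ /=; rewrite coefMX /= ?mulr0n ?mul0r //.
by rewrite coef_deriv mulrnAl.
Qed.

Lemma lin_indep_exprs N s : is_subfield N -> N (s ^+ p) -> ~ N s ->
  lin_indep N (fun r : 'I_p => s ^+ r).
Proof.
move=> sfN Nsp nNs c Nc cs; pose P := \poly_(i < p) oapp c 0 (insub i).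
have PE (i : 'I_p) : P`_i = c i by rewrite coef_poly ltn_ord insubT ?ltn_ord //= => ?; congr c; apply: val_inj.
have NP i : N P`_i.
  rewrite coef_poly; case: ifP => _; last exact: subfield0.
  by case: insub => [j|] /=; [exact: Nc|exact: subfield0].
have P0 : P = 0.
  apply: (horner_eq0_p char_p sfN Nsp nNs NP); first exact: size_poly.
  rewrite (horner_coef_wide _ (size_poly _ _)) -[RHS]cs.
  by apply: eq_bigr => i _; rewrite PE.
by move=> i; rewrite -PE P0 coef0.
Qed.

End ExtensionStep.

(** * An extension of exponent one more, not modular over L *)

Section NonModularStep.
Variables (R : fieldType) (p : nat) (char_p : p \in [pchar R]).
Hypothesis perfectR : forall n (x : R), exists y, y ^+ (p ^ n) = x.
Variables (F : set R) (e : nat) (G L : set R) (t : R).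
Hypotheses (sfF : is_subfield F) (bG : equi_basis p F e G).
Hypotheses (Ft : F t) (t_root : forall x, adjoin F G x -> x ^+ p != t).
Hypotheses (sfL : is_subfield L) (FL : F `<=` L).

Let p_pr : prime p := pcharf_prime char_p.
Let H : set R := powers (p ^ e) G.
(** A common field of coefficients: it is contained in F, and in [N C] for every twisted basis C
    used in [twist_coefs], while D0(H) contains [N G]. *)
Let D0 : set R := adjoin (powers (p ^ e.+1) F) (powers (p ^ 1) H).

(** The p^n-th power field of M' = F(C^(1/p)), where n = e + 1 is the exponent of M. *)
Let N C : set R := powers (p ^ e.+1) (adjoin F (proots p C)).

Let D0_F : D0 `<=` F.
Proof.
apply: adjoin_min => //; first exact: powers_sub.
by rewrite /H powers_powers addn1; case: bG.
Qed.

Let N_E C : N C = adjoin (powers (p ^ e.+1) F) (powers (p ^ e) C).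
Proof. by rewrite /N (powers_adjoin char_p) powers_proots. Qed.

Let sfN C : is_subfield (N C).
Proof. by apply: subfield_powers => //; exact: adjoin_subfield. Qed.

Let t_neq0 : t != 0.
Proof.
have := t_root (subfield0 (adjoin_subfield F G)).
by rewrite expr0n eqn0Ngt prime_gt0 // eq_sym.
Qed.

Lemma modular_coefs C n (c y : 'I_n -> R) :
  modular p L (adjoin F (proots p C)) -> (forall i, L (c i)) ->
  lin_indep (N C) c -> (forall i, N C (y i)) ->
  L (\sum_i y i * c i) -> forall i, L (y i).
Proof.
move=> modC Lc cN; apply: (coefs_in_subfield (sfN C) sfL) => //.
by apply: (lin_disjointC (sfN C) sfL _ _ (@modC e.+1));
  [exact: (subfield_setI (sfN C) sfL)|move=> x []].
Qed.

(** An element of L outside F is expanded with coefficients in [N G] on elements of F independent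
    over [N G]. By modularity these coefficients are in L, and they are not all in F. *)
Lemma exists_coef_outside x : modular p L (adjoin F (proots p G)) ->
  L x -> ~ F x -> adjoin F H x -> exists f, [/\ L f, N G f & ~ F f].
Proof.
move=> modG Lx nFx Hx; have sfC := subfield_setI (sfN G) sfF.
have HN : H `<=` N G by rewrite N_E; exact: mem_adjoin.
have bG' := equi_basis_proots perfectR bG.
have dFN : lin_disjoint F (N G) (N G `&` F).
  apply: (lin_disjointC (sfN G) sfF sfC); first by move=> y [].
  exact: (equi_basis_modular char_p sfF bG').
have Np y : N G y -> exists n, F (y ^+ (p ^ n)).
  move=> [z Fz <-]; exists 1%N; rewrite -exprM -expnD addn1.
  by apply: (powers_adjoin_exponent char_p sfF (proj1 bG')); exists z.
have NGx : adjoin F (N G) x by move: Hx; exact: adjoinS.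
have [n [c [y [_ [_ Fc cN Ny xE]]]]] := compositum_expand char_p sfF sfC (sfN G)
  (sfN G) (@subIsetl _ _ _) (@subset_refl _ _) dFN Np NGx.
have Lc i : L (c i) by exact: FL.
rewrite xE in Lx; have Ly := modular_coefs modG Lc cN Ny Lx.
apply: contrapT => /forallNP nf; apply: nFx; rewrite xE.
apply: subfield_sum => // i _; apply: subfieldM => //.
by apply: contrapT => nFy; apply: (nf (y i)).
Qed.

(** The twisted generator gives g - om = s v with v in N. Expanding P(g) around om and separating
    the powers of s, independent over N, puts each Q_r v^r in L; [euler_horner] assembles the
    result. *)
Lemma twist_coefs g0 w (P : {poly R}) Y :
  G g0 -> adjoin F (G `\ g0) w -> N (twist G g0 w t) (w ^+ (p ^ e)) ->
  modular p L (adjoin F (proots p (twist G g0 w t))) ->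
  is_subfield Y -> Y `<=` adjoin D0 (H `\ (g0 ^+ (p ^ e))) ->
  (forall i, Y P`_i) -> (size P <= p)%N -> L P.[g0 ^+ (p ^ e)] ->
  L ((g0 ^+ (p ^ e) - w ^+ (p ^ e)) * P^`().[g0 ^+ (p ^ e)]).
Proof.
set Gc := twist G g0 w t; set g := g0 ^+ (p ^ e); set om := w ^+ (p ^ e).
move=> Gg0 Gw Nom modC sfY YD YP szP Lf.
have bC : equi_basis p F e Gc by exact: equi_basis_twist.
pose z := (w + (g0 - w) / t) ^+ (p ^ e); pose s := t ^+ (p ^ e).
have s0 : s != 0 by rewrite expf_neq0.
have zE : z = om + (g - om) / s by exact: (frobenius_twist char_p).
have HN : powers (p ^ e) Gc `<=` N Gc by rewrite N_E; exact: mem_adjoin.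
have Nz : N Gc z by apply: HN; exists (w + (g0 - w) / t) => //; right.
have HgN : H `\ g `<=` N Gc.
  rewrite -(powersD1 char_p); apply: subset_trans HN; apply: powersS.
  by move=> x Gx; left.
have FN : powers (p ^ e.+1) F `<=` N Gc by rewrite N_E; exact: sub_adjoin.
have Nsp : N Gc (s ^+ p).
  by apply: FN; exists t; rewrite // /s -exprM -expnSr.
(* If s were in N, then t would have a p-th root in M', which by [proots_socle] would already lie in
   M. *)
have nNs : ~ N Gc s.
  move=> [y Cy ys]; have yt : y ^+ p = t.
    by apply: (expr_p_inj char_p (n := e)); rewrite /= -exprM -expnS.
  have : adjoin F Gc y by apply: (proots_socle char_p perfectR sfF bC Cy); rewrite yt.
  rewrite /Gc (adjoin_twist Gg0 Gw Ft t_neq0) => /t_root.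
  by rewrite yt eqxx.
pose v := z - om; have Nv : N Gc v by exact: (subfieldB (sfN Gc)).
have gE : g - om = s * v by rewrite /v zE; field.
have D0N : D0 `<=` N Gc.
  apply: adjoin_min => // _ [h Hh <-]; rewrite expn1.
  have [->|hg] := pselect (h = g).
    (* The element g need not be in N, but g^p = om^p + s^p v^p is. *)
    have -> : g = om + s * v by rewrite -gE; ring.
    rewrite -[_ ^+ p]/(frobenius char_p 1 _) rmorphD rmorphM /=.
    apply: (subfieldD (sfN Gc)); first exact: (subfieldX (sfN Gc)).
    by apply: (subfieldM (sfN Gc)) => //; exact: (subfieldX (sfN Gc)).
  by apply: (subfieldX (sfN Gc)); apply: HgN.
have YN : Y `<=` N Gc by apply: subset_trans YD _; exact: adjoin_min.
pose Q := P \Po ('X + om%:P).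
have NQ i : N Gc Q`_i.
  have [P1 P1E] := subfield_polyP (sfN Gc) (fun i => YN _ (YP i)).
  have [o oE] := subfield_typeP (sfN Gc) Nom.
  have -> : Q = map_poly val (P1 \Po ('X + o%:P)).
    rewrite map_comp_poly -P1E /Q oE; congr (_ \Po _).
    by rewrite rmorphD; congr (_ + _); symmetry; [exact: map_polyX|exact: map_polyC].
  exact: subfield_poly_coef.
have szX : size ('X + om%:P) = 2%N by rewrite size_XaddC.
have szQ : (size Q <= p)%N by rewrite size_comp_poly2.
have QE (A : {poly R}) : (A \Po ('X + om%:P)).[g - om] = A.[g].
  by rewrite horner_comp hornerD hornerX hornerC subrK.
have fE : P.[g] = \sum_(r < p) (Q`_r * v ^+ r) * s ^+ r.
  rewrite -QE -/Q (horner_coef_wide _ szQ); apply: eq_bigr => r _.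
  by rewrite gE exprMn mulrCA mulrC -mulrA mulrCA.
have Lc : forall r : 'I_p, L (Q`_r * v ^+ r).
  apply: (modular_coefs modC (c := fun r : 'I_p => s ^+ r)).
  - by move=> r; apply: FL; do 2! apply: subfieldX => //.
  - exact: (lin_indep_exprs char_p (sfN Gc)).
  - by move=> r; apply: (subfieldM (sfN Gc)); [exact: NQ|exact: (subfieldX (sfN Gc))].
  - by rewrite -fE.
have -> : P^`().[g] = Q^`().[g - om].
  by rewrite /Q deriv_comp derivD derivX derivC addr0 mulr1 QE.
rewrite -(euler_horner _ szQ); apply: subfield_sum => // r _.
apply: subfieldMn => //; rewrite gE exprMn mulrCA mulrC.
apply: (subfieldM sfL (Lc r)).
by apply: FL; do 2! apply: subfieldX => //.
Qed.

Lemma non_modular_step : (exists2 x, L x & ~ F x) ->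
  L `<=` adjoin F H -> ~ (adjoin F H `<=` L) -> G !=set0 ->
  exists G', [/\ equi_basis p F e.+1 G', G' !=set0,
    adjoin F G `<=` adjoin F G',
    forall x, adjoin F G' x -> F (x ^+ p) -> adjoin F G x &
    ~ modular p L (adjoin F G')].
Proof.
move=> [x Lx nFx] LH nHL [g1 Gg1].
have prootsP C : equi_basis p F e C -> C !=set0 -> adjoin F C = adjoin F G ->
    ~ modular p L (adjoin F (proots p C)) ->
  exists G', [/\ equi_basis p F e.+1 G', G' !=set0,
    adjoin F G `<=` adjoin F G',
    forall x, adjoin F G' x -> F (x ^+ p) -> adjoin F G x &
    ~ modular p L (adjoin F G')].
  move=> bC [c Cc] CG nmod; exists (proots p C); split=> //.
  - exact: equi_basis_proots.
  - by have [y yc] := perfectR 1 c; exists y; rewrite /proots /roots /= -[p]/(p ^ 1)%N yc.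
  - by rewrite -CG; exact: sub_adjoin_proots.
  - by move=> y Cy yp; rewrite -CG; apply: (proots_socle char_p perfectR sfF bC).
(* If no M' works, F(C^(1/p)) is modular over L for every basis C of M, in particular for the
   twisted ones. *)
apply: contrapT => none.
have all_mod C : equi_basis p F e C -> C !=set0 -> adjoin F C = adjoin F G ->
    modular p L (adjoin F (proots p C)).
  by move=> bC C0 CG; apply: contrapT => nmod; apply: none; exact: (prootsP C).
have modG : modular p L (adjoin F (proots p G)).
  by apply: all_mod => //; exists g1.
have [f [Lf Nf nFf]] := exists_coef_outside modG Lx nFx (LH _ Lx).
have D0f : adjoin D0 H f.
  by move: Nf; rewrite N_E; apply: adjoinSl; exact: sub_adjoin.
have sfD0 : is_subfield D0 := adjoin_subfield _ _.
have [_ [s [[g0 Gg0 <-] sH nsf sgf]]] :=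
  adjoin_peel sfD0 D0f (contra_not (@D0_F f) nFf).
set g := g0 ^+ (p ^ e) in sH sgf.
pose Y := adjoin D0 [set` s]; have sfY : is_subfield Y := adjoin_subfield _ _.
have YD : Y `<=` adjoin D0 (H `\ g) by exact: adjoinS.
have Hg : H g by exists g0.
have Ygp : Y (g ^+ p).
  by apply: sub_adjoin; apply: mem_adjoin; exists g; rewrite ?expn1.
have nYg : ~ Y g.
  case: bG => _ /(_ _ Hg); apply: contra_not => /YD; exact: adjoinSl.
have [P [YP szP fP]] := adjoin1_pP char_p sfY Ygp sgf.
(* P is not constant, as P(g) = f is outside Y, so P' is a nonzero polynomial of degree < p over Y
   and cannot vanish at g. *)
pose ka := P^`().[g].
have ka0 : ka != 0.
  apply/negP => /eqP ka0; have /negP[] : P^`() != 0.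
    apply: (deriv_neq0_small char_p); rewrite szP andbT ltnNge.
    apply/negP => /size1_polyC PE; apply: nsf; rewrite fP PE hornerC.
    exact: YP.
  apply/eqP; apply: (horner_eq0_p char_p sfY Ygp nYg) ka0.
    by move=> i; rewrite coef_deriv; exact: (subfieldMn sfY).
  by apply: leq_trans (size_poly _ _) (leq_trans (leq_pred _) szP).
have Lka w : adjoin F (G `\ g0) w -> N (twist G g0 w t) (w ^+ (p ^ e)) ->
    L ((g - w ^+ (p ^ e)) * ka).
  move=> Gw Nw; apply: (twist_coefs Gg0 Gw Nw _ sfY) => //.
    apply: all_mod; last exact: adjoin_twist.
      exact: equi_basis_twist.
    by exists (w + (g0 - w) / t); right.
  by rewrite -fP.
have sfG' := adjoin_subfield F (G `\ g0).
(* The choices w = 0 and w = 1 put g ka and (g - 1) ka in L, hence ka and g; each other generator h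
   is then reached with w = h. *)
have L0 : L (g * ka).
  have := Lka 0 (subfield0 sfG'); rewrite expr0n expn_eq0 eqn0Ngt prime_gt0 //=.
  by rewrite subr0; apply; exact: (subfield0 (sfN _)).
have L1 : L ka.
  have := Lka 1 (subfield1 sfG'); rewrite expr1n => /(_ (subfield1 (sfN _))) L1.
  have -> : ka = g * ka - (g - 1) * ka by ring.
  exact: subfieldB.
have Lg : L g by rewrite -[g](mulfK ka0); exact: subfield_div.
apply: nHL; apply: adjoin_min => // _ [h Gh <-].
have [->//|hg] := pselect (h = g0).
have Lh : L ((g - h ^+ (p ^ e)) * ka).
  apply: Lka; first by apply: mem_adjoin; split.
  by rewrite N_E; apply: mem_adjoin; exists h => //; left; split.
have -> : h ^+ (p ^ e) = g - (g - h ^+ (p ^ e)) * ka / ka by field.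
by apply: subfieldB => //; exact: subfield_div.
Qed.

End NonModularStep.

(** * Degrees, r-bases and countability *)

Section Degrees.
Variables (R : fieldType) (p : nat) (char_p : p \in [pchar R]).
Implicit Types (B D F G H L U V : set R) (x y : R).

Let p_pr : prime p := pcharf_prime char_p.

Lemma adjoin_spanning F (s : seq R) : is_subfield F ->
  (forall a, a \in s -> F (a ^+ p)) ->
  exists (T : finType) (b : T -> R), #|T| = (p ^ size s)%N /\
    forall x, adjoin F [set` s] x ->
      exists2 c : T -> R, forall i, F (c i) & x = \sum_i c i * b i.
Proof.
move=> sfF; elim: s => [|a s IHs] sp.
  exists unit, (fun=> 1); split=> [|x]; first by rewrite card_unit.
  rewrite adjoin_id // => Fx; exists (fun=> x) => //.
  by rewrite (bigD1 tt) //= big1 ?addr0 ?mulr1 // => -[].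
have [|T [b [cT bP]]] := IHs; first by move=> x xs; apply: sp; rewrite inE xs orbT.
exists ('I_p * T)%type, (fun i : 'I_p * T => a ^+ i.1 * b i.2); split=> [|x sx].
  by rewrite card_prod card_ord cT expnS.
have sfs := adjoin_subfield F [set` s].
have {sx} : adjoin (adjoin F [set` s]) [set a] x.
  rewrite adjoinU; move: sx; apply: adjoinS => y /=.
  by rewrite inE => /orP[/eqP ->|]; [right|left].
have ap : adjoin F [set` s] (a ^+ p) by apply: sub_adjoin; apply: sp; exact: mem_head.
move=> /(adjoin1_pP char_p sfs ap)[P [Ps szP ->]].
have /choice[c cP] (i : 'I_p) : exists c : T -> R,
    (forall j, F (c j)) /\ P`_i = \sum_j c j * b j.
  by have [c] := bP _ (Ps i); exists c.
exists (fun i : 'I_p * T => c i.1 i.2) => [[i j]|]; first by have [] := cP i.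
rewrite (horner_coef_wide _ szP) -(pair_bigA _ (fun (i : 'I_p) j => c i j * (a ^+ i * b j))) /=.
apply: eq_bigr => i _; have [_ ->] := cP i; rewrite mulr_suml.
by apply: eq_bigr => j _; rewrite mulrAC mulrA.
Qed.

Lemma rindep_lin_indep F H n (x : 'I_n -> R) : is_subfield F -> rindep F H ->
  injective x -> range x `<=` H -> lin_indep F x.
Proof.
move=> sfF iH x_inj xH c Fc cx i; apply: contrapT => /eqP ci.
apply: (iH (x i)); first by apply: xH; exists i.
have sfY := adjoin_subfield F (H `\ x i).
have xE : x i = - (\sum_(j | j != i) c j * x j) / c i.
  by move: cx; rewrite (bigD1 i) //= => /eqP; rewrite addr_eq0 => /eqP <-; field.
rewrite [X in adjoin _ _ X]xE; apply: (subfield_div sfY); last exact: sub_adjoin.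
apply: (subfieldN sfY); apply: (subfield_sum sfY) => j /eqP ji.
apply: (subfieldM sfY); first exact: sub_adjoin.
by apply: mem_adjoin; split=> [|/x_inj //]; apply: xH; exists j.
Qed.

Lemma rbasis_exponent1 F V B : is_subfield F -> is_subfield V -> F `<=` V ->
  powers p V `<=` F -> B `<=` V ->
  is_rbasis p F V B <-> V = adjoin F B /\ rindep F B.
Proof.
move=> sfF sfV FV Vp BV; rewrite /is_rbasis (adjoin_id sfF Vp).
by split=> [[_ VE iB]//|[VE iB]]; split.
Qed.

(** Zorn's lemma: a dependence involves finitely many elements, so the union of a chain is
    independent, and a maximal independent B generates V by [rindep_setU1]. *)
Lemma exists_rbasis F V : is_subfield F -> is_subfield V -> F `<=` V ->
  powers p V `<=` F -> exists B, is_rbasis p F V B.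
Proof.
move=> sfF sfV FV Vp.
have [|B [[BV iB] maxB]] := @Zorn_bigcup R (fun B => B `<=` V /\ rindep F B).
  move=> E EP totE; split=> [x [X EX Xx]|x [X EX Xx]].
    by have [XV _] := EP _ EX; exact: XV.
  move=> /adjoin_finite[s sE sx].
  have [Y [EY sY Yx]] : exists Y, [/\ E Y, [set` s] `<=` Y & Y x].
    elim: s sE {sx} => [|a s IHs] sE; first by exists X.
    have [|Y [EY sY Yx]] := IHs; first by move=> y ys; apply: sE; rewrite /= inE ys orbT.
    have [[Z EZ Za] _] : (\bigcup_(X in E) X `\ x) a by apply: sE; rewrite /= mem_head.
    have [YZ|ZY] := totE _ _ EY EZ.
      exists Z; split=> // [y /=|]; last exact: YZ.
      by rewrite inE => /orP[/eqP ->//|/sY/YZ].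
    exists Y; split=> // y /=.
    by rewrite inE => /orP[/eqP ->|/sY//]; exact: ZY.
  have [_ /(_ x Yx)] := EP _ EY; apply; move: sx; apply: adjoinS => y ys.
  by split; [exact: sY|have [] := sE _ ys].
exists B; apply/rbasis_exponent1 => //; split=> //.
apply/seteqP; split; last exact: adjoin_min.
move=> x Vx; apply: contrapT => nBx; apply: (maxB (B `|` [set x])).
  split; first by move=> y; left.
  by move=> /(_ x (or_intror erefl))/(@mem_adjoin _ F).
split; first by move=> y [/BV//|->].
by apply: (rindep_setU1 char_p sfF) => // [y /BV Vy|]; apply: Vp; [exists y|exists x].
Qed.

End Degrees.

(** A dependence of x_i involves a finite list v of other indices. The field generated by x_i and
    the x_j, j in v, would then be spanned by p^|v| monomials, although p-independence gives it
    degree p^(|v|+1). *)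
Lemma p_independent_notin (k : fieldType) (p : nat) (I : eqType) (x : I -> k) i :
  p \in [pchar k] -> p_independent p x ->
  ~ adjoin (powers p [set: k]) (x @` [set~ i]) (x i).
Proof.
move=> char_p indx; set F := powers p _.
have sfF : is_subfield F.
  by apply: (subfield_powers char_p 1); apply: subfieldP.
move=> /adjoin_finite[s sx xs].
have [u [iu su]] : exists u : seq I, i \notin u /\ {subset s <= map x u}.
  elim: s sx {xs} => [|a s IHs] sx; first by exists [::].
  have [|u [iu su]] := IHs; first by move=> y ys; apply: sx; rewrite /= inE ys orbT.
  have [j ji ja] : (x @` [set~ i]) a by apply: sx; rewrite /= mem_head.
  exists (j :: u); split; first by rewrite inE negb_or iu andbT; apply/eqP => /esym.
  by move=> y; rewrite /= !inE ja => /orP[->//|/su ->]; rewrite orbT.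
pose v := undup u; have iv : i \notin v by rewrite mem_undup.
pose t := in_tuple (i :: v).
have t_inj : injective (tnth t).
  by apply/tuple_uniqP; rewrite /= iv undup_uniq.
have [b [bt bi _]] := indx _ _ t_inj.
have sxv : adjoin F [set` map x v] (x i).
  move: xs; apply: adjoinS => y /= /su /mapP[j ju ->].
  by rewrite map_f // mem_undup.
have tv : adjoin F (range (x \o tnth t)) `<=` adjoin F [set` map x v].
  apply: adjoin_mono; first exact: sub_adjoin.
  move=> _ [j _ <-] /=; have := mem_tnth j t; rewrite /= inE => /orP[/eqP -> //|jv].
  by apply: mem_adjoin; rewrite /= map_f.
have [|T [c [cT cP]]] := adjoin_spanning char_p sfF (s := map x v).
  by move=> a _; exists a.
have := steinitz sfF (fun j => cP _ (tv _ (bt j))) bi.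
by rewrite cT size_map leq_exp2l ?prime_gt1 ?(pcharf_prime char_p) //= ltnn.
Qed.

(** * Countability and degree of irrationality *)

Section Countability.
Variables (k R : fieldType) (iota : {rmorphism k -> R}).
Variables (p : nat) (char_p : p \in [pchar R]).
Hypothesis k_countable : countable [set: k].

Local Notation F := (range iota).
Let sfF : is_subfield F := subfield_range iota.

Lemma countable_roots n : countable (roots (p ^ n) F).
Proof.
have [f f_inj] := countable_injP _ k_countable.
apply/countable_injP; exists (fun x => f (xget 0 [set c | iota c = x ^+ (p ^ n)])).
move=> x y; rewrite !inE => -[c _ cx] [d _ dy] /f_inj.
have gE z e : iota e = z ^+ (p ^ n) -> xget 0 [set c | iota c = z ^+ (p ^ n)] = e.
  move=> ez; apply: (fmorph_inj iota); rewrite ez.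
  by apply: (@xgetPex _ 0 [set c | iota c = z ^+ (p ^ n)]); exists e.
rewrite (gE x c cx) (gE y d dy) !inE => /(_ I I) cd.
by apply: (expr_p_inj char_p (n := n)); rewrite /= -cx -dy cd.
Qed.

(** A subextension of finite degree is generated by a basis inside the countable set of p-th roots
    of F, so it is determined by the list of codes of that basis. *)
Lemma countable_finite_proper_subexts V : V `<=` roots (p ^ 1) F ->
  countable (finite_proper_subexts F V).
Proof.
move=> VF; have [f f_inj] := countable_injP _ (countable_roots 1).
pose Phi (s : seq nat) := adjoin F [set x | roots (p ^ 1) F x /\ f x \in s].
apply: (@sub_countable _ _ _ (Phi @` [set: seq nat])); last first.
  exact: sub_countable (card_image_le _ _) (countableP _).
apply: subset_card_le => L [[sfL [FL _] [LV _]] [d [b [Lb bi bP]]]].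
exists [seq f (b i) | i <- enum 'I_d] => //; apply/seteqP; split.
  apply: adjoin_min => // x [Fx /mapP[i _ fx]].
  have -> // : x = b i.
  by apply: f_inj => //; rewrite inE //; apply: VF; exact: LV.
move=> x /bP[c Fc ->]; apply: (subfield_sum (adjoin_subfield _ _)) => i _.
apply: (subfieldM (adjoin_subfield _ _)); first exact: sub_adjoin.
apply: mem_adjoin; split; first by apply: VF; exact: LV.
by rewrite map_f // mem_enum.
Qed.

(** H is itself an r-basis at level n = 1, which gives the lower bound. At every level the r-bases
    are countable because k is, hence no larger than the infinite set H. *)
Lemma has_di_socle H U : is_subfield U -> F `<=` U -> infinite_set H ->
  rindep F H -> roots p F `&` U = adjoin F H -> has_di p F U H.
Proof.
move=> sfU FU Hinf iH UE; split=> [n B _ [BU _ _]|D leD].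
  apply: card_le_trans (_ : _ #<= [set: nat]) _; last exact/infiniteP.
  apply: sub_countable (countable_roots n).
  by apply: subset_card_le => x /BU[].
have sfV : is_subfield (roots p F `&` U).
  by apply: subfield_setI => //; exact: (subfield_roots char_p 1).
apply: (leD 1%N) => //; apply/rbasis_exponent1 => //.
- by move=> x Fx; split; [exact: subfieldX|exact: FU].
- by move=> _ [x [Fx _] <-].
- by rewrite [X in _ `<=` X]UE; exact: mem_adjoin.
Qed.

End Countability.

(** * The tower *)

Lemma closed_root (R : closedFieldType) n (x : R) : (0 < n)%N ->
  exists y, y ^+ n = x.
Proof.
move=> n0; have : size ('X^n - x%:P) != 1%N.
  by rewrite size_XnsubC // eqSS -lt0n.
move=> /closed_rootP[y]; rewrite rootE hornerD hornerN hornerXn hornerC subr_eq0.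
by move/eqP; exists y.
Qed.

Section Tower.
Variables (k : fieldType) (R : closedFieldType) (iota : {rmorphism k -> R}).
Variables (p : nat) (char_k : p \in [pchar k]).
Variables (k_countable : countable [set: k]).
Variables (X : nat -> k) (t : k).
Hypothesis Xt_indep : p_independent p (fun o : option nat => oapp X t o).

Local Notation F := (range iota).
Let sfF : is_subfield F := subfield_range iota.
Let char_p : p \in [pchar R] := rmorph_pchar iota char_k.
Let p_pr : prime p := pcharf_prime char_p.

Lemma closed_perfect n (x : R) : exists y, y ^+ (p ^ n) = x.
Proof. by apply: closed_root; rewrite expn_gt0 prime_gt0. Qed.
Let perfectR := closed_perfect.

Definition gens q : set R := [set a | exists i, a ^+ q = iota (X i)].

(** Taking p-th powers pulls a dependence back to k over k^p, against p-independence. The index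
    [None] stands for t, so that one statement covers both the X_i and t. *)
Lemma root_notin (o : option nat) a : a ^+ p = iota (oapp X t o) ->
  ~ adjoin F [set y | exists2 o', o' <> o & y ^+ p = iota (oapp X t o')] a.
Proof.
move=> ao; set S := [set y | _] => Sa.
have : powers (p ^ 1) (adjoin F S) (a ^+ (p ^ 1)) by exists a.
rewrite (powers_adjoin char_p) expn1 ao.
set P := powers p [set: k]; pose S' := oapp X t @` [set~ o].
have : adjoin (iota @` P) (iota @` S') (iota (oapp X t o)) ->
    adjoin P S' (oapp X t o) by rewrite -image_adjoin image_fmorphE.
move=> h Sao; apply: (p_independent_notin char_k Xt_indep (i := o)); apply: h.
move: Sao; apply: adjoin_mono.
  move=> _ [_ [c _ <-] <-]; apply: sub_adjoin; exists (c ^+ p); first by exists c.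
  by rewrite rmorphXn.
move=> _ [y [o' o'o yo'] <-]; apply: mem_adjoin; rewrite yo'.
by exists (oapp X t o') => //; exists o'.
Qed.

Lemma gens_rindep : rindep F (gens p).
Proof.
move=> a [i ai]; apply: contra_not (@root_notin (Some i) _ ai); apply: adjoinS.
move=> y [[j yj] ya]; exists (Some j) => // -[ji]; apply: ya.
by apply: (expr_p_inj char_p (n := 1)); rewrite /= expn1 ai yj ji.
Qed.

Lemma t_root_notin a : a ^+ p = iota t -> ~ adjoin F (gens p) a.
Proof.
move=> ai; apply: contra_not (@root_notin None _ ai); apply: adjoinS.
by move=> y [j yj]; exists (Some j).
Qed.

Lemma X_inj : injective X.
Proof.
move=> i j Xij; apply: contrapT => ij.
apply: (p_independent_notin char_k Xt_indep (i := Some i)).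
by apply: mem_adjoin; exists (Some j) => //= -[/esym].
Qed.

Lemma exists_gens : exists a : nat -> R, injective a /\ forall i, a i ^+ p = iota (X i).
Proof.
have /choice[a aP] i := closed_root (iota (X i)) (prime_gt0 p_pr).
exists a; split=> // i j aij; apply: X_inj; apply: (fmorph_inj iota).
by rewrite -!aP aij.
Qed.

Lemma gens_infinite : infinite_set (gens p).
Proof.
have [a [a_inj aP]] := exists_gens; apply/infiniteP.
apply: (card_le_trans _ (subset_card_le (_ : a @` [set: nat] `<=` gens p))).
  by rewrite (card_le_eqr (inj_card_eq _)) // => i j _ _; exact: a_inj.
by move=> _ [i _ <-]; exists i.
Qed.

Local Notation M1 := (adjoin F (gens p)).

Lemma gens_roots : gens p `<=` roots (p ^ 1) F.
Proof. by move=> a [i ai]; rewrite /roots /= expn1 ai; exists (X i). Qed.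

Lemma M1_roots : M1 `<=` roots (p ^ 1) F.
Proof.
apply: adjoin_min; first exact: subfield_roots.
  by move=> x Fx; exact: subfieldX.
exact: gens_roots.
Qed.

Lemma equi_basis_gens1 : equi_basis p F 0 (gens p).
Proof.
split; last by rewrite powers0; exact: gens_rindep.
by move=> _ [a Ga <-]; exact: gens_roots.
Qed.

Lemma powers_gens2 : powers (p ^ 1) (gens (p ^ 2)) = gens p.
Proof.
apply/seteqP; split=> [_ [a [i ai] <-]|a [i ai]].
  by exists i; rewrite -exprM.
have [b ba] := perfectR 1 a; exists b => //; exists i.
by rewrite (expnD p 1 1) exprM ba expn1.
Qed.

Lemma equi_basis_gens2 : equi_basis p F 1 (gens (p ^ 2)).
Proof.
split; last by rewrite powers_gens2; exact: gens_rindep.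
rewrite -(powers_powers p 1 1) powers_gens2 => _ [a Ga <-].
exact: gens_roots.
Qed.

Lemma socle_equi_basis e G : equi_basis p F e G ->
  roots p F `&` adjoin F G = adjoin F (powers (p ^ e) G).
Proof.
move=> bG; apply/seteqP; split=> [x [Fx Gx]|].
  by apply: (socle char_p (m := 0)) => //; rewrite ?addn0 // /roots /= expn1.
have sfG := adjoin_subfield F G.
apply: adjoin_min.
- by apply: subfield_setI => //; exact: (subfield_roots char_p 1).
- by move=> x Fx; split; [exact: subfieldX|exact: sub_adjoin].
- move=> _ [g Gg <-]; split; last by apply: (subfieldX sfG); exact: mem_adjoin.
  by rewrite /roots /= -exprM -expnSr; case: bG => Ge _; apply: Ge; exists g.
Qed.

(** The invariant of the tower, M standing for M_(e+1). Keeping the socle equal to M_1 ensures that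
    it contains every L_n and that M contains no p-th root of t. *)
Definition stage e M := [/\ exists2 G, equi_basis p F e G & M = adjoin F G,
  M !=set0 & roots p F `&` M = M1].

Lemma exists_step n M L : stage n.+1 M -> proper_subext F L M1 ->
  exists M', extension_step iota p n.+2 M L M' /\ stage n.+2 M'.
Proof.
move=> [[G bG ->] _ socM] [sfL [FL nLF] [LM1 nM1L]].
have socG := socle_equi_basis bG; rewrite socM in socG.
have troot x : adjoin F G x -> x ^+ p != iota t.
  move=> Gx; apply/eqP => xt; apply: (t_root_notin xt); rewrite -socM.
  by split=> //; rewrite /roots /= xt; exists t.
have Ft : F (iota t) by exists t.
have [||//||G' [bG' [g' G'g] GG' socG' nmod]] :=
  non_modular_step char_p perfectR sfF bG Ft troot sfL FL.
- by have /existsNP[x /not_implyP[Lx nFx]] := nLF; exists x.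
- by rewrite -socG.
- by rewrite -socG.
(* If G were empty, M_1 would be F, leaving no room for L. *)
- apply/set0P/negP => /eqP G0; apply: nM1L; rewrite socG G0.
  by rewrite /powers image_set0 adjoin_id.
have socE : roots p F `&` adjoin F G' = M1.
  rewrite -socM; apply/seteqP; split=> x [Fx Gx]; split=> //; last exact: GG'.
  exact: socG'.
have FG' : F `<=` adjoin F G' := @sub_adjoin _ _ _.
exists (adjoin F G'); split; last first.
  by split=> //; [exists G'|exists g'; exact: mem_adjoin].
split=> //.
- exists (gens p).
    by apply: (has_di_socle char_p k_countable) => //;
      [exact: adjoin_subfield|exact: gens_infinite|exact: gens_rindep].
  by apply: (has_di_socle char_p k_countable) => //;
    [exact: adjoin_subfield|exact: sub_adjoin|exact: gens_infinite|exact: gens_rindep].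
- by rewrite socE socM.
- by apply: equi_basis_equiexponential => //; exists g'.
Qed.

Lemma stage1 : stage 0 M1.
Proof.
split; first by exists (gens p) => //; exact: equi_basis_gens1.
  by exists 0; exact: (subfield0 (adjoin_subfield _ _)).
by apply/setIidPr => x /M1_roots; rewrite /roots /= expn1.
Qed.

Lemma stage2 : stage 1 (adjoin F (gens (p ^ 2))).
Proof.
split; first by exists (gens (p ^ 2)) => //; exact: equi_basis_gens2.
  by exists 0; exact: (subfield0 (adjoin_subfield _ _)).
by rewrite (socle_equi_basis equi_basis_gens2) powers_gens2.
Qed.

Lemma exists_tower (L : nat -> set R) :
  (forall n, (3 <= n)%N -> proper_subext F (L n) M1) ->
  exists M, tower iota p X L M.
Proof.
(* The pair (n, M) encodes M as a candidate for M_(n+2); [set0] is a filler value when the invariant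
   fails. *)
move=> LP; have /choice[g gP] (nM : nat * set R) : exists M',
    stage nM.1.+1 nM.2 -> extension_step iota p nM.1.+2 nM.2 (L nM.1.+3) M' /\
      stage nM.1.+2 M'.
  have [sM|nsM] := pselect (stage nM.1.+1 nM.2); last by exists set0.
  by have [M' M'P] := exists_step sM (LP nM.1.+3 isT); exists M'.
pose N := fix N n := if n is m.+1 then g (m, N m) else adjoin F (gens (p ^ 2)).
have sN n : stage n.+1 (N n).
  elim: n => [|n IHn]; first exact: stage2.
  by have [] := gP (n, N n) IHn.
(* Here [N m] is M_(m+2), and index 0 receives M_1 as a filler. *)
exists (fun n => if n is m.+2 then N m else M1); split=> // -[|[|n]] // _.
by have [] := gP (n, N n) (sN n).
Qed.

(** * The union of the tower *)

Section TowerProperties.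
Variables (L M : nat -> set R).
Hypothesis L_enum : enumerates_proper_subexts F M1 L.
Hypothesis M_tower : tower iota p X L M.

(** The tower is an arbitrary one satisfying the step conditions, so its bases are recovered from
    equiexponentiality by [equiexponential_equi_basis]. *)
Lemma tower_stage n : stage n (M n.+1).
Proof.
have [M1E M2E stepM] := M_tower; case: n => [|n]; first by rewrite M1E; exact: stage1.
elim: n => [|n [[G bG MG] M0 socM]]; first by rewrite M2E; exact: stage2.
have [MM' _ socM' eqM' _] := stepM n.+2 isT; split.
- exact: (equiexponential_equi_basis char_p eqM').
- by have [x Mx] := M0; exists x; exact: MM'.
- by rewrite socM'.
Qed.

Lemma tower_sub n : M n.+1 `<=` M n.+2.
Proof.
have [M1E M2E stepM] := M_tower; case: n => [|n]; last by have [] := stepM n.+2 isT.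
rewrite M1E M2E -[root_ext _ _ _]/(M1) -powers_gens2.
apply: adjoin_mono; first exact: sub_adjoin.
by move=> _ [x Gx <-]; apply: (subfieldX (adjoin_subfield _ _)); exact: mem_adjoin.
Qed.

Lemma tower_le m n : (m <= n)%N -> M m.+1 `<=` M n.+1.
Proof.
move=> /subnKC <-; elim: (n - m)%N => [|d IHd]; first by rewrite addn0.
by apply: subset_trans IHd _; rewrite addnS; exact: tower_sub.
Qed.

Let K : set R := \bigcup_(n in [set n | (1 <= n)%N]) M n.

Let K_mem x : K x -> exists n, M n.+1 x.
Proof. by move=> [[|n]//] _ Mx; exists n. Qed.

Let sub_K n : M n.+1 `<=` K.
Proof. by move=> x Mx; exists n.+1. Qed.

Lemma tower_subfield n : is_subfield (M n.+1).
Proof. by have [[G _ ->] _ _] := tower_stage n; exact: adjoin_subfield. Qed.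

Lemma tower_base n : F `<=` M n.+1.
Proof. by have [[G _ ->] _ _] := tower_stage n; exact: sub_adjoin. Qed.

Lemma tower_exponent n : powers (p ^ n.+1) (M n.+1) `<=` F.
Proof.
have [[G [Ge _] ->] _ _] := tower_stage n.
exact: powers_adjoin_exponent.
Qed.

Lemma union_subfield : is_subfield K.
Proof.
apply: subfield_bigcup; first by exists 1%N.
- by move=> [|n] // _; exact: tower_subfield.
- move=> [|m] // [|n] // _ _; exists (maxn m n).+1; split=> //.
    by apply: tower_le; exact: leq_maxl.
  by apply: tower_le; exact: leq_maxr.
Qed.

Lemma union_insep x : K x -> exists n, F (x ^+ (p ^ n)).
Proof.
by move=> /K_mem[n Mx]; exists n.+1; apply: (@tower_exponent n); exists x.
Qed.

Lemma union_purely_insep : purely_insep p F K.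
Proof.
split; [exact: union_subfield| |exact: union_insep].
exact: subset_trans (@tower_base 0) (@sub_K 0).
Qed.

Lemma union_socle : roots p F `&` K = M1.
Proof.
have [_ _ soc0] := tower_stage 0; apply/seteqP; split=> [x [Fx /K_mem[n Mx]]|x].
  by have [_ _ <-] := tower_stage n.
by rewrite -soc0 => -[Fx /sub_K].
Qed.

(** In a later M_(N+1) = F(H), x lies in F(H^(p^(N-n))) by [socle]. This field has the same exponent
    and the same socle as M_(n+1) and contains it, so the two agree by [equi_basis_socle_sub]. *)
Lemma union_roots n : K `&` roots (p ^ n.+1) F `<=` M n.+1.
Proof.
move=> x [/K_mem[m Mx] xF]; pose N := maxn m n.
have {}Mx : M N.+1 x by apply: tower_le Mx; exact: leq_maxl.
have nN : (n <= N)%N by exact: leq_maxr.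
have [[G bG MnE] _ socG] := tower_stage n.
have [[H bH MNE] _ socH] := tower_stage N.
pose d := (N - n)%N; rewrite -(subnK nN) -/d in bH.
have bHd := equi_basis_powers bH.
have xH : adjoin F (powers (p ^ d) H) x.
  by apply: (socle char_p sfF bH) => //; rewrite -MNE.
have HN : adjoin F (powers (p ^ d) H) `<=` M N.+1.
  rewrite MNE; apply: adjoin_mono; first exact: sub_adjoin.
  move=> _ [y Hy <-]; apply: (subfieldX (adjoin_subfield _ _)).
  exact: mem_adjoin.
rewrite MnE; move: x xH {Mx xF}.
apply: (equi_basis_socle_sub char_p perfectR sfF bG bHd).
  move=> x; rewrite -MnE => Mx; apply: (socle char_p sfF bH).
    by rewrite -MNE; exact: (tower_le nN).
  by apply: (@tower_exponent n); exists x.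
move=> x /HN MNx xp; rewrite -MnE.
have : M1 x by rewrite -socH.
by rewrite -socG => -[].
Qed.

Lemma union_modular : modular p F K.
Proof.
move=> m n x Kx xi.
have /choice[y yP] i : exists y, K y /\ y ^+ (p ^ m) = x i.
  by have [y Ky <-] := Kx i; exists y.
have [N MN] : exists N, forall i, M N.+1 (y i).
  have /choice[f fP] i : exists j, M j.+1 (y i).
    by apply: K_mem; have [] := yP i.
  exists (\max_i f i) => i; apply: tower_le (fP i); exact: leq_bigmax.
have [[G bG ME] _ _] := tower_stage N.
apply: (equi_basis_modular char_p sfF bG (n := m)).
  by move=> i; rewrite -ME; have [_ <-] := yP i; exists (y i).
rewrite -ME; apply: lin_indepS xi => z [Mz Fz]; split=> //.
by move: Mz; apply: powersS; exact: sub_K.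
Qed.

Lemma union_di : has_di p F K (gens p).
Proof.
apply: (has_di_socle char_p k_countable union_subfield).
- exact: subset_trans (@tower_base 0) (@sub_K 0).
- exact: gens_infinite.
- exact: gens_rindep.
- exact: union_socle.
Qed.

Lemma di_le_dim U j : is_subfield U -> F `<=` U -> di_le p F U j ->
  exists N, forall m (x : 'I_m -> R), (forall i, (roots p F `&` U) (x i)) ->
    lin_indep F x -> (m <= N)%N.
Proof.
move=> sfU FU [C [leC _] Cj].
have sfV : is_subfield (roots p F `&` U).
  by apply: subfield_setI => //; exact: (subfield_roots char_p 1).
have FV : F `<=` roots p F `&` U.
  by move=> x Fx; split; [exact: subfieldX|exact: FU].
have Vp : powers p (roots p F `&` U) `<=` F by move=> _ [x [Fx _] <-].
have [B rB] := exists_rbasis char_p sfF sfV FV Vp.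
have BC : B #<= C by apply: (leC 1%N).
have BV : B `<=` roots p F `&` U by case: rB.
have /finite_seqP[s Bs] : finite_set B.
  by apply/finite_set_leP; exists j; exact: card_le_trans BC Cj.
have [VB _] := (rbasis_exponent1 sfF sfV FV Vp BV).1 rB.
have [|T [b [cT bP]]] := adjoin_spanning char_p sfF (s := s).
  by move=> a sa; have [] : (roots p F `&` U) a by apply: BV; rewrite Bs.
exists #|T| => m x Vx xi; apply: (steinitz sfF _ xi) => i.
by apply: bP; rewrite -Bs -VB.
Qed.

Lemma union_w0_generated j : w0_generated p F K j.
Proof.
move=> [U [[sfU [FU _] [UK _]] unbU diU]].
have [N dimN] := di_le_dim sfU FU diU.
have [m0 [[d degQ] stable]] := socle_part_stable char_p sfF sfU FU dimN.
have Qmod := socle_part_modular char_p sfF union_subfield sfU FU UK union_insep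
  union_modular stable.
set Q := (_ `&` _ `&` _) in degQ stable Qmod.
have QM1 : Q `<=` M1 by move=> x [[Fx Ux] _]; rewrite -union_socle; split=> //; exact: UK.
have properQ : proper_subext F Q M1.
  split.
  - apply: subfield_setI; last exact: adjoin_subfield.
    by apply: subfield_setI => //; exact: (subfield_roots char_p 1).
  - split.
      by move=> x Fx; split; [split; [exact: subfieldX|exact: FU]|exact: sub_adjoin].
    (* Suppose Q = F and descend from a p^n-th power of y = x^(p^m0) lying in F: a power of y whose
       p-th power is in F belongs to Q, hence to F. So y is in F, and m0 would bound the
       exponent. *)
    move=> QF; apply: unbU; exists m0 => _ [x Ux <-].
    apply: contrapT => nFx.
    set y := x ^+ (p ^ m0) in nFx.
    have [n Fy] : exists n, F (y ^+ (p ^ n)).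
      by apply: union_insep; apply: UK; exact: subfieldX.
    elim: n Fy => [/nFx//|n IHn]; rewrite expnSr exprM => Fyp; apply: IHn.
    apply: QF; split; first by split=> //; do 2! apply: subfieldX => //.
    apply: (subfieldX (adjoin_subfield _ _)); apply: mem_adjoin.
    by exists x.
  - split; first exact: QM1.
    (* The p-th roots of N + 1 of the X_i are independent over F, too many to fit in Q, whose
       independent families have at most N elements. *)
    move=> M1Q; have [a [a_inj aP]] := exists_gens.
    have := dimN N.+1 (fun i => a i); rewrite ltnn => h; suff: false by [].
    apply: h => [i|].
      have [//] : Q (a i) by apply: M1Q; apply: mem_adjoin; exists i.
    apply: (rindep_lin_indep sfF gens_rindep) => [i i' /a_inj/val_inj//|].
    by move=> _ [i _ <-]; exists i.
have [Lproper Lall] := L_enum.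
(* Having finite degree, Q is some L_(n+3), while [Qmod] makes M_(n+3) modular over it. *)
have [|[|[|[|n]]] // _ LQ] := Lall Q; first by split=> //; exists d.
have [_ _ stepM] := M_tower; have [_ _ _ _] := stepM n.+2 isT; apply.
rewrite LQ; apply: (Qmod n.+3).
- exact: tower_subfield.
- exact: sub_K.
- exact: tower_exponent.
- exact: union_roots.
Qed.

End TowerProperties.
End Tower.

Theorem mainTheorem3 (k : fieldType) (Omega : closedFieldType)
    (iota : {rmorphism k -> Omega})
    (Omega_alg : forall x : Omega, algebraicOver iota x)
    (p : nat) (char_p : p \in [pchar k])
    (k_countable : countable [set: k])
    (k_imperfect : infinite_imperfection k p)
    (X : nat -> k) (t : k)
    (Xt_indep : p_independent p (fun o : option nat => oapp X t o)) :
  countable (finite_proper_subexts (range iota) (root_ext iota p X)) /\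
  forall L : nat -> set Omega,
    enumerates_proper_subexts (range iota) (root_ext iota p X) L ->
    (exists M : nat -> set Omega, tower iota p X L M) /\
    forall M : nat -> set Omega, tower iota p X L M ->
      let K := \bigcup_(n in [set n | (1 <= n)%N]) M n in
      [/\ forall n, (1 <= n)%N -> M n `<=` M n.+1,
          forall n, (3 <= n)%N -> ~ modular p (L n) (M n),
          forall n, (3 <= n)%N -> equiexponential iota p (M n) n,
          purely_insep p (range iota) K &
          [/\ modular p (range iota) K,
              infty_w0_generated p (range iota) K &
              di_infinite p (range iota) K]].
Proof.
have char_Omega := rmorph_pchar iota char_p.
split.
  by apply: (countable_finite_proper_subexts char_Omega k_countable); exact: M1_roots.
move=> L L_enum; split.
  by apply: (exists_tower char_p k_countable Xt_indep); case: L_enum.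
move=> M M_tower K; have [_ _ stepM] := M_tower; split.
- by move=> [|n] // _; exact: (tower_sub char_p M_tower).
- by move=> [|[|[|n]]] // _; have [] := stepM n.+2 isT.
- by move=> [|[|[|n]]] // _; have [] := stepM n.+2 isT.
- exact: (union_purely_insep char_p Xt_indep M_tower).
- split.
  + exact: (union_modular char_p Xt_indep M_tower).
  + by move=> j _; exact: (union_w0_generated char_p Xt_indep L_enum M_tower).
  + exists (gens iota X p); last exact: (gens_infinite char_p Xt_indep).
    exact: (union_di char_p k_countable Xt_indep M_tower).
Qed.
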